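(* Let $\varepsilon>0$. The bilinear form $A(u_\sigma,v_\sigma)=\int_\Omega u_\sigma v_\sigma\,\mathrm{d}x+\varepsilon j(u_\sigma,v_\sigma)$ satisfies $$A(u_\sigma,u_\sigma)\geq C(\varepsilon)\|u_\sigma\|_{L^2(\Omega_\sigma)}^2\qquad\forall u_\sigma\in V_\sigma^P(\Omega_\sigma),$$ with a constant $C(\varepsilon)>0$ independent of $\sigma$, $u_\sigma$, and the position of $\partial\Omega$ relative to the Cartesian grid.
   Context: Grid. Let $d\in\mathbb{N}$, $P\in\mathbb{N}_0$, $\sigma>0$. For $i\in\mathbb{Z}^d$ let $x_i:=(i_1\sigma,\ldots,i_d\sigma)$ be the Cartesian grid points (nodes), $\Omega_i:=\prod_{l=1}^d((i_l-1)\sigma,(i_l+1)\sigma)$ the patches, $\omega_i:=\prod_{l=1}^d((i_l-\tfrac12)\sigma,(i_l+\tfrac12)\sigma)$ the patch-cores, and $Q_i:=\prod_{l=1}^d(i_l\sigma,(i_l+1)\sigma)$ the elements. Partition of unity. Let $\zeta:\mathbb{R}\to\mathbb{R}$, $\zeta(x)=K^{-1}\exp(-1/(1-4x^2))$ for $|x|<\tfrac12$ and $\zeta(x)=0$ otherwise, with $K>0$ such that $\|\zeta\|_{L^1(\mathbb{R})}=1$; on $\mathbb{R}^d$ put $\zeta(x)=\prod_{l=1}^d\zeta(x_l)$ and $\zeta_\sigma(x)=\sigma^{-d}\zeta(x/\sigma)$. Set $\varphi_i:=\chi_{\omega_i}\star\zeta_\sigma$ (convolution with the characteristic function of $\omega_i$).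 The $\varphi_i$ are $C^\infty$, have support $\operatorname{clos}\Omega_i$, and sum to $1$. Domains. $\Omega\subset\mathbb{R}^d$ is a domain for which Stein's extension theorem holds (there is a bounded linear extension operator $W^{k,2}(\Omega)\to W^{k,2}(\mathbb{R}^d)$ for every $k\in\mathbb{N}$). The fictitious domain is $\Omega_\sigma:=\operatorname{int}\bigcup\lbrace\operatorname{clos}Q_i\mid\operatorname{meas}_d(Q_i\cap\Omega)>0\rbrace$; the cut part is $\Omega_\sigma^\Gamma:=\operatorname{int}\bigcup\lbrace\operatorname{clos}Q_i\mid Q_i\subset\Omega_\sigma,\ Q_i\not\subset\Omega\rbrace$; the uncut part is $\Omega_\sigma^\circ:=\operatorname{int}\bigcup\lbrace\operatorname{clos}Q_i\mid Q_i\subset\Omega_\sigma,\ Q_i\subset\Omega\rbrace$. One writes $Q_i\in\Omega_\sigma^\Gamma$ for $Q_i\subset\Omega_\sigma^\Gamma$, and similarly for the other domains. Two elements are neighbors if they share at least one grid node. Standing assumption: for every $Q_i\in\Omega_\sigma^\Gamma$ there is a finite sequence $(Q_i=Q_{i,1},\ldots,Q_{i,K})$ of elements in $\Omega_\sigma^\Gamma$ with $K$ bounded independently of $\sigma$, any two subsequent elements being neighbors, and $Q_{i,K}$ having a neighbor in $\Omega_\sigma^\circ$ (if necessary, this is enforced by moving additional elements from $\Omega_\sigma^\circ$ to $\Omega_\sigma^\Gamma$). Space and forms. $V_\sigma^P(\Omega_\sigma)$ is the span of the functions $\varphi_i x^\alpha$, $|\alpha|\leq P$, $i\in\mathbb{Z}^d$,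 restricted to $\Omega_\sigma$. The stabilization form is $$j(u,v):=\sigma^{2(P+1)}\sum_{Q_i\in\Omega_\sigma^\Gamma}\sum_{|\alpha|=P+1}\int_{Q_i}(\partial^\alpha u)(\partial^\alpha v)\,\mathrm{d}x.$$ *)

(* Defs.v *)
From HB Require Import structures.
From mathcomp Require Import all_boot all_order all_algebra.
From mathcomp Require Import all_classical all_reals all_analysis.

Set Implicit Arguments.
Unset Strict Implicit.
Unset Printing Implicit Defensive.

Import Order.TTheory GRing.Theory Num.Theory.
Import numFieldNormedType.Exports.

Local Open Scope classical_set_scope.
Local Open Scope ring_scope.

(* Lebesgue measure on the space 'rV[R]_n of row vectors, which the library
   equips with a topology and a norm but with neither a sigma-algebra nor a
   measure. *)

Section measurable_rV.
Context {R : realType} {n : nat}.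

Let coord : 'I_n -> 'rV[R]_n -> measurableTypeR R := fun i x => x ord0 i.

Let rV_set0 : g_sigma_preimage coord set0.
Proof. exact: sigma_algebra0. Qed.

Let rV_setC A : g_sigma_preimage coord A -> g_sigma_preimage coord (~` A).
Proof. exact: sigma_algebraC. Qed.

Let rV_bigcup (F : _^nat) : (forall i, g_sigma_preimage coord (F i)) ->
  g_sigma_preimage coord (\bigcup_i (F i)).
Proof. exact: sigma_algebra_bigcup. Qed.

(* The product sigma-algebra, generated by the coordinates; it is the Borel
   sigma-algebra of 'rV[R]_n. *)
HB.instance Definition _ := @isMeasurable.Build
  (measure_tuple_display R.-ocitv.-measurable.-sigma)
  'rV[R]_n (g_sigma_preimage coord) rV_set0 rV_setC rV_bigcup.

End measurable_rV.

Section lebesgue_rV.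
Context {R : realType}.

Definition cons_rV n (p : measurableTypeR R * 'rV[R]_n) : 'rV[R]_n.+1 :=
  row_mx (const_mx p.1 : 'rV[R]_1) p.2.

Lemma measurable_coord n (i : 'I_n) :
  measurable_fun [set: 'rV[R]_n] (fun x => x ord0 i : measurableTypeR R).
Proof.
move=> _ Y mY; rewrite setTI; apply: sub_sigma_algebra => /=.
rewrite -bigcup_seq/=; exists i => /=; first by rewrite mem_index_enum.
by exists Y => //; rewrite setTI.
Qed.

Lemma measurable_fun_rVP d (T : measurableType d) n (f : T -> 'rV[R]_n) :
  (forall i, measurable_fun [set: T] (fun x => f x ord0 i : measurableTypeR R)) ->
  measurable_fun [set: T] f.
Proof.
move=> mf _ Y mY; rewrite setTI.
have : g_sigma_preimage (fun i (x : 'rV[R]_n) => x ord0 i : measurableTypeR R)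
    `<=` [set A | measurable (f @^-1` A)].
  apply: smallest_sub => /=.
    split => //=; first by rewrite preimage_set0.
    - by move=> A mA; rewrite setTD preimage_setC; exact: measurableC.
    - by move=> F mF; rewrite preimage_bigcup; exact: bigcupT_measurable.
  rewrite -bigcup_seq/= => A [i _ [B mB <-]] /=; rewrite setTI.
  by have := mf i measurableT B mB; rewrite setTI.
exact.
Qed.

Lemma measurable_cons_rV n : measurable_fun setT (@cons_rV n).
Proof.
apply: measurable_fun_rVP => i.
case: (@split_ordP 1 n i) => j ->.
  rewrite (_ : (fun _ => _) = fst)//.
  by apply/funext => -[a b] /=; rewrite (row_mxEl (const_mx a : 'rV_1)) mxE.
rewrite (_ : (fun _ => _) =
    (fun x : 'rV[R]_n => x ord0 j : measurableTypeR R) \o snd).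
  apply: measurableT_comp; first exact: measurable_coord.
  exact: measurable_snd.
by apply/funext => -[a b] /=; rewrite (row_mxEr (const_mx a : 'rV_1)).
Qed.

Definition uncons_rV n (x : 'rV[R]_n.+1) : measurableTypeR R * 'rV[R]_n :=
  (x ord0 ord0, \row_j x ord0 (lift ord0 j)).

Lemma measurable_uncons_rV n : measurable_fun setT (@uncons_rV n).
Proof.
apply/measurable_fun_pairP; split; first exact: measurable_coord.
apply: measurable_fun_rVP => i.
rewrite (_ : (fun _ => _) =
    fun x : 'rV[R]_n.+1 => x ord0 (lift ord0 i) : measurableTypeR R).
  exact: measurable_coord.
by apply/funext => x /=; rewrite mxE.
Qed.

Lemma cons_rVK n : cancel (@cons_rV n) (@uncons_rV n).
Proof.
move=> [a b]; rewrite /uncons_rV /cons_rV /=; congr pair.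
  rewrite (_ : ord0 = lshift n (ord0 : 'I_1)); last exact/val_inj.
  by rewrite (row_mxEl (const_mx a : 'rV_1)) mxE.
apply/rowP => j; rewrite mxE.
rewrite (_ : lift ord0 j = rshift 1 j); last exact/val_inj.
by rewrite (row_mxEr (const_mx a : 'rV_1)).
Qed.

Section step.
Context n (m : {sigma_finite_measure set 'rV[R]_n -> \bar R}).

Definition lebesgue_rVS : set 'rV[R]_n.+1 -> \bar R :=
  pushforward (lebesgue_measure \x m)%E (@cons_rV n).

Let rVS0 : lebesgue_rVS set0 = 0%E.
Proof. by rewrite /lebesgue_rVS /pushforward preimage_set0 measure0. Qed.

Let rVS_ge0 A : (0 <= lebesgue_rVS A)%E.
Proof. by rewrite /lebesgue_rVS /pushforward; apply: measure_ge0. Qed.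

Let rVS_sigma_additive : semi_sigma_additive lebesgue_rVS.
Proof.
move=> F mF tF mUF; rewrite /lebesgue_rVS /pushforward preimage_bigcup.
have mpre A : measurable A -> measurable (@cons_rV n @^-1` A).
  by move=> mA; rewrite -[X in measurable X]setTI; exact: measurable_cons_rV.
apply: measure_semi_sigma_additive.
- by move=> k; apply: (mpre (F k)); apply: mF.
- apply/trivIsetP => /= i j _ _ ij; rewrite -preimage_setI.
  by move/trivIsetP : tF => /(_ _ _ _ _ ij) ->//; rewrite preimage_set0.
- by rewrite -preimage_bigcup; exact: mpre.
Qed.

HB.instance Definition _ := isMeasure.Build _ _ _ lebesgue_rVS
  rVS0 rVS_ge0 rVS_sigma_additive.

Let rVS_sigma_finite : sigma_finite setT lebesgue_rVS.
Proof.
have /sigma_finiteP[F [TF ndF Foo]] := sigma_finiteT (@lebesgue_measure R).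
have /sigma_finiteP[G [TG ndG Goo]] := sigma_finiteT m.
exists (fun k => @uncons_rV n @^-1` (F k `*` G k)).
  apply/seteqP; split=> // x _.
  have [i _ Fi] : (\bigcup_i F i) (uncons_rV x).1 by rewrite -TF.
  have [j _ Gj] : (\bigcup_i G i) (uncons_rV x).2 by rewrite -TG.
  exists (maxn i j) => //; split.
    by move: Fi; exact/subsetPset/ndF/leq_maxl.
  by move: Gj; exact/subsetPset/ndG/leq_maxr.
move=> k; have [mF Fkoo] := Foo k; have [mG Gkoo] := Goo k; split.
  rewrite -[X in measurable X]setTI; apply: measurable_uncons_rV => //.
  exact: measurableX.
rewrite /lebesgue_rVS /pushforward.
rewrite (_ : _ @^-1` _ = F k `*` G k); last first.
  rewrite -comp_preimage (_ : _ \o _ = id) ?preimage_id//.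
  by apply/funext => p; exact: cons_rVK.
by rewrite product_measure1E// lte_mul_pinfty// ge0_fin_numE.
Qed.

HB.instance Definition _ := Measure_isSigmaFinite.Build _ _ _ lebesgue_rVS
  rVS_sigma_finite.

End step.

Fixpoint lebesgue_rV n : {sigma_finite_measure set 'rV[R]_n -> \bar R} :=
  if n is n'.+1 then lebesgue_rVS (lebesgue_rV n')
  else dirac (0 : 'rV[R]_0).

Lemma measurable_box n (A : 'I_n -> set (measurableTypeR R)) :
  (forall i, measurable (A i)) ->
  measurable [set x : 'rV[R]_n | forall i, A i (x ord0 i)].
Proof.
move=> mA; rewrite (_ : [set _ | _] =
    \bigcap_(i in [set: 'I_n]) [set x : 'rV[R]_n | A i (x ord0 i)]).
  apply: fin_bigcap_measurable => // i _.
  by have := @measurable_coord n i measurableT _ (mA i); rewrite setTI.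
by apply/seteqP; split=> x /= Ax i => [_|]; exact: Ax.
Qed.

Lemma lebesgue_rV_box n (A : 'I_n -> set (measurableTypeR R)) :
  (forall i, measurable (A i)) ->
  lebesgue_rV n [set x | forall i, A i (x ord0 i)] =
  (\prod_(i < n) lebesgue_measure (A i))%E.
Proof.
elim: n A => [|n IHn] A mA.
  rewrite big_ord0 [LHS]diracE mem_set//= => -[]//.
pose B := [set x : 'rV[R]_n | forall i, A (lift ord0 i) (x ord0 i)].
have mB : measurable B := @measurable_box n (fun i => A (lift ord0 i)) (fun i => mA _).
rewrite big_ord_recl -(IHn (fun i => A (lift ord0 i)))// -/B.
transitivity ((lebesgue_measure \x lebesgue_rV n)%E (A ord0 `*` B)); last first.
  by rewrite product_measure1E.
rewrite /= /lebesgue_rVS /pushforward.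
congr (_ _); apply/seteqP; split=> -[a b] /=.
  move=> Aab; split=> [|i].
    by have /= := Aab ord0; have [-> _] := cons_rVK (a, b).
  by have := Aab (lift ord0 i); have [_ /rowP/(_ i)] := cons_rVK (a, b);
    rewrite mxE => ->.
move=> [Aa Ab] i; have [ha /rowP hb] := cons_rVK (a, b).
by case: (unliftP ord0 i) => [j ->|->]; [have := hb j; rewrite mxE => ->|rewrite ha].
Qed.

End lebesgue_rV.

Section calculus.
Context {R : realType} {d : nat}.
Implicit Types (D : set 'rV[R]_d) (u v f g : 'rV[R]_d -> R) (a : 'I_d -> nat).

Definition monomial a (x : 'rV[R]_d) : R := \prod_(l < d) x ord0 l ^+ a l.

(* The derivatives along the coordinate axes are taken one after the other, the
   last coordinate first. *)
Definition partial a f : 'rV[R]_d -> R :=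
  foldr (fun l => iter (a l) (fun h x => 'D_(delta_mx ord0 l) h x)) f
    (enum 'I_d).

Definition convolution f g (x : 'rV[R]_d) : R :=
  \int[lebesgue_rV d]_y (f y * g (x - y)).

Definition L2norm D u : R :=
  Num.sqrt (\int[lebesgue_rV d]_(x in D) (u x ^+ 2)).

Definition memL2 D u : Prop :=
  measurable_fun D u /\
  (\int[lebesgue_rV d]_(x in D) ((u x ^+ 2)%:E) < +oo)%E.

Definition test_function D f : Prop :=
  (forall a, continuous (partial a f) /\
     forall x l, derivable (partial a f) x (delta_mx ord0 l)) /\
  exists2 S : set 'rV[R]_d, compact S /\ S `<=` D &
    forall x, ~ S x -> f x = 0.

Definition weak_derivative D a u v : Prop :=
  forall f, test_function D f ->
    \int[lebesgue_rV d]_(x in D) (u x * partial a f x) =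
    (- 1) ^+ (\sum_(l < d) a l)%N * \int[lebesgue_rV d]_(x in D) (v x * f x).

(* The multi-indices of order at most k are the elements of
   {ffun 'I_d -> 'I_k.+1} whose entries add up to at most k. *)
Definition sobolev (k : nat) D u : Prop :=
  memL2 D u /\
  forall a : {ffun 'I_d -> 'I_k.+1}, (\sum_(l < d) a l <= k)%N ->
    exists2 v, memL2 D v & weak_derivative D (fun l => a l) u v.

(* Any two choices of the weak derivative agree almost everywhere in D. *)
Definition wderiv D a u : 'rV[R]_d -> R :=
  get [set v | memL2 D v /\ weak_derivative D a u v].

Definition sobolev_norm (k : nat) D u : R :=
  Num.sqrt (\sum_(a : {ffun 'I_d -> 'I_k.+1} | (\sum_(l < d) a l <= k)%N)
              L2norm D (wderiv D (fun l => a l) u) ^+ 2).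

Definition extension_operator (k : nat) D
    (E : ('rV[R]_d -> R) -> ('rV[R]_d -> R)) : Prop :=
  [/\ forall u, sobolev k D u -> sobolev k setT (E u),
      forall u, sobolev k D u ->
        {ae lebesgue_rV d, forall x, D x -> E u x = u x},
      forall (c : R) u v, sobolev k D u -> sobolev k D v ->
        {ae lebesgue_rV d, forall x,
           E (fun y => c * u y + v y) x = c * E u x + E v x} &
      exists M : R, forall u, sobolev k D u ->
        sobolev_norm k setT (E u) <= M * sobolev_norm k D u].

Definition stein_domain D : Prop :=
  [/\ open D, connected D, D !=set0 &
      forall k, (0 < k)%N -> exists E, extension_operator k D E].

End calculus.

Section particle_partition_of_unity.
Context {R : realType} {d : nat}.
Implicit Types (s : R) (i j : 'rV[int]_d) (Om D : set 'rV[R]_d)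
  (M : set 'rV[int]_d) (P : nat) (u v : 'rV[R]_d -> R).

Definition node s i : 'rV[R]_d := \row_l ((i ord0 l)%:~R * s).

Definition core s i : set 'rV[R]_d :=
  [set x | forall l, ((i ord0 l)%:~R - 2^-1) * s < x ord0 l
                       < ((i ord0 l)%:~R + 2^-1) * s].

Definition element s i : set 'rV[R]_d :=
  [set x | forall l, (i ord0 l)%:~R * s < x ord0 l
                       < ((i ord0 l)%:~R + 1) * s].

Definition bump (x : R) : R :=
  if `|x| < 2^-1 then expR (- (1 - 4 * x ^+ 2)^-1) else 0.

(* Dividing by the integral of bump, which plays the role of K, makes zeta1 of
   unit mass. *)
Definition zeta1 (x : R) : R := (\int[lebesgue_measure]_y bump y)^-1 * bump x.

Definition zeta (x : 'rV[R]_d) : R := \prod_(l < d) zeta1 (x ord0 l).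

Definition zeta_scaled s (x : 'rV[R]_d) : R := s ^- d * zeta (s^-1 *: x).

Definition pou s i : 'rV[R]_d -> R :=
  convolution (\1_(core s i)) (zeta_scaled s).

(* Only the values of u on D matter: u is a finite linear combination of the
   functions pou s i * x^a, |a| <= P, restricted to D.  Such a combination is
   smooth with compact support, so that the integrals below are finite and the
   sum in the stabilization form has finitely many nonzero terms. *)
Definition pum_space P s D u : Prop :=
  exists w : seq (R * 'rV[int]_d * {ffun 'I_d -> nat}),
    (forall t, t \in w -> (\sum_(l < d) t.2 l <= P)%N) /\
    forall x, D x ->
      u x = \sum_(t <- w) t.1.1 * (pou s t.1.2 x * monomial t.2 x).

Definition union_elements s (I : set 'rV[int]_d) : set 'rV[R]_d :=
  interior (\bigcup_(i in I) closure (element s i)).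

Definition fictitious s Om : set 'rV[R]_d :=
  union_elements s
    [set i | (0 < lebesgue_rV d (element s i `&` Om))%E].

(* M indexes the uncut elements that are moved to the cut part. *)
Definition cut_part s Om M : set 'rV[R]_d :=
  union_elements s [set i | element s i `<=` fictitious s Om /\
                            (~ element s i `<=` Om \/ M i)].

Definition uncut_part s Om M : set 'rV[R]_d :=
  union_elements s [set i | element s i `<=` fictitious s Om /\
                            (element s i `<=` Om /\ ~ M i)].

Definition movable s Om M : Prop :=
  forall i, M i -> element s i `<=` uncut_part s Om set0.

Definition neighbors s i j : Prop :=
  exists k, closure (element s i) (node s k) /\
            closure (element s j) (node s k).

Definition chain_condition (K : nat) s Om M : Prop :=
  forall i, element s i `<=` cut_part s Om M ->
    exists (n : nat) (q : nat -> 'rV[int]_d),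
      [/\ (n < K)%N, q 0%N = i,
          forall m, (m <= n)%N -> element s (q m) `<=` cut_part s Om M,
          forall m, (m < n)%N -> neighbors s (q m) (q m.+1) &
          exists j, element s j `<=` uncut_part s Om M /\
                    neighbors s (q n) j].

Definition stab_form P s Om M u v : R :=
  s ^+ (2 * P.+1) *
  \sum_(i \in [set i | element s i `<=` cut_part s Om M])
    \sum_(a : {ffun 'I_d -> 'I_P.+2} | (\sum_(l < d) a l == P.+1)%N)
      \int[lebesgue_rV d]_(x in element s i)
        (partial (fun l => a l) u x * partial (fun l => a l) v x).

Definition stab_bilinear P (eps : R) s Om M u v : R :=
  \int[lebesgue_rV d]_(x in Om) (u x * v x) + eps * stab_form P s Om M u v.

End particle_partition_of_unity.

(* Main.v *)
(* The trial functions are tensor products: pou s i x = prod_l hat (x_l/s - i_l)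
   for a smooth function hat supported in [-1, 1].  Hence, after the affine
   change of variable x = s (y + i), the trial functions restricted to two
   neighboring elements range over a fixed finite-dimensional space, independent
   of s, of i and of the domain.  On that space the L2 mass on the first element
   is bounded by the L2 mass on the second one plus the L2 norms of the
   derivatives of order P+1 on the first one: both sides are positive
   semidefinite quadratic forms, and if the right-hand side vanishes then the
   function is a polynomial of degree at most P on the first element, all of
   whose derivatives vanish at a node shared with the second one.  Following the
   chains of cut elements, the mass of each element is bounded by the energies of
   the elements at grid distance at most K, and each element is used a bounded
   number of times. *)
From HB Require Import structures.
Require Import Defs.
From mathcomp Require Import all_boot all_order all_algebra.
From mathcomp Require Import all_classical all_reals all_analysis.
From mathcomp Require Import measurable_realfun.
From mathcomp Require Import ring lra zify.

Set Implicit Arguments.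
Unset Strict Implicit.
Unset Printing Implicit Defensive.

Import Order.TTheory GRing.Theory Num.Theory.
Import numFieldNormedType.Exports.

Local Open Scope classical_set_scope.
Local Open Scope ring_scope.

(** * Lebesgue measure on row vectors *)

(** The estimate for two neighboring elements comes without an explicit constant:
    [psd_form_dominated] turns an inclusion of kernels into an inequality. It is applied to
    coefficient vectors rather than functions, so the generators may be linearly dependent. The
    kernel inclusion rests on smoothness across element faces: vanishing on an open element then
    passes to all derivatives on its closure, in particular at the shared node. This is why [bump]
    is shown to be smooth, through the family [flat]. Independence of [s] is due to the weight
    [s ^+ (2 * P.+1)]: the chain rule gives each derivative of order P+1 a factor s^(P+1), and all
    integrals carry the same factor s^d. Derivatives enter the estimate on the first element only. A
    chain can therefore end in an uncut element, which contributes its mass but no stabilization. *)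

Section measure.
Context {R : realType}.
Local Notation mu := (@lebesgue_measure R).

Lemma ge0_integral_rVS n (f : 'rV[R]_n.+1 -> \bar R) :
  measurable_fun setT f -> (forall x, 0 <= f x)%E ->
  (\int[lebesgue_rV n.+1]_x f x =
   \int[mu]_a \int[lebesgue_rV n]_b f (cons_rV (a, b)))%E.
Proof.
move=> mf f0.
transitivity (\int[lebesgue_measure \x lebesgue_rV n]_p f (cons_rV p))%E.
  rewrite [LHS](_ : _ = \int[pushforward (lebesgue_measure \x lebesgue_rV n)%E
    (@cons_rV R n)]_x f x)%E //.
  rewrite ge0_integral_pushforward//.
  exact: measurable_cons_rV.
rewrite fubini_tonelli1//.
apply: measurableT_comp => //.
exact: measurable_cons_rV.
Qed.

(** By uniqueness of Lebesgue measure: the pushforward under x -> s (x + c), scaled by s, gives each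
    half-open interval its length. *)
Lemma lebesgue_measure_affine (s c : R) (s0 : 0 < s) (A : set R) : measurable A ->
  mu A = (s%:E * mu [set x | A (s * (x + c))%R])%E.
Proof.
move=> mA.
pose phi (x : measurableTypeR R) : measurableTypeR R := s * (x + c).
have mphi : measurable_fun setT phi.
  apply: (@continuous_measurable_fun _ _) => x.
  by apply: cvgMr; apply: cvgD; [exact: cvg_id|exact: cvg_cst].
pose phi_m := HB.pack_for {mfun measurableTypeR R >-> measurableTypeR R} phi
  (isMeasurableFun.Build _ _ _ _ _ mphi).
rewrite (@lebesgue_measure_unique _ (mscale (NngNum (ltW s0)) (pushforward mu
  phi_m)))//.
move=> _ [[a b] _ <-].
rewrite /= /mscale /pushforward /=.
rewrite [pushforward _ _ _]/(mu (phi @^-1` `]a, b]%classic)) (_ : _ @^-1` _ =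
  `]s^-1 * a - c, s^-1 * b - c]%classic); last first.
  apply/seteqP; split => x /=; rewrite !in_itv/= /phi => /andP[h1 h2].
  - by rewrite ltrBlDr lerBrDr -(ltr_pM2l s0) -(ler_pM2l s0) !mulVKf ?gt_eqF// h1.
  - by move: h1 h2; rewrite ltrBlDr lerBrDr -(ltr_pM2l s0) -(ler_pM2l s0) !mulVKf
      ?gt_eqF// => -> ->.
rewrite lebesgue_measure_itv -[lebesgue_stieltjes_measure _]/(mu)
  lebesgue_measure_itv/=.
rewrite !lte_fin ltrD2r (ltr_pM2l (_ : 0 < s^-1)) ?invr_gt0//.
case: ifPn => _; last by rewrite mule0.
by rewrite -!EFinD -EFinM; congr EFin; field; rewrite gt_eqF.
Qed.

Lemma ge0_integral_affine (s c : R) (s0 : 0 < s) (f : R -> \bar R) :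
  measurable_fun [set: R] f -> (forall x, 0 <= f x)%E ->
  (\int[mu]_x f x = s%:E * \int[mu]_x f (s * (x + c))%R)%E.
Proof.
move=> mf f0.
pose phi (x : measurableTypeR R) : measurableTypeR R := s * (x + c).
have mphi : measurable_fun setT phi.
  apply: (@continuous_measurable_fun _ _) => x.
  by apply: cvgMr; apply: cvgD; [exact: cvg_id|exact: cvg_cst].
pose phi_m := HB.pack_for {mfun measurableTypeR R >-> measurableTypeR R} phi
  (isMeasurableFun.Build _ _ _ _ _ mphi).
rewrite (@eq_measure_integral _ _ _ _ (mscale (NngNum (ltW s0)) (pushforward mu
  phi_m))).
  rewrite ge0_integral_mscale//= ge0_integral_pushforward//.
by move=> A mA _; exact: (lebesgue_measure_affine c s0 mA).
Qed.

Lemma cons_rV0 n (p : R * 'rV[R]_n) : cons_rV p ord0 ord0 = p.1.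
Proof. by case: p => a b; have [] := cons_rVK (a, b). Qed.

Lemma cons_rVS n (p : R * 'rV[R]_n) (j : 'I_n) :
  cons_rV p ord0 (lift ord0 j) = p.2 ord0 j.
Proof. by case: p => a b; have [_ /rowP/(_ j)] := cons_rVK (a, b); rewrite mxE. Qed.

Lemma cons_rV_affine n (s a : R) (b : 'rV[R]_n) (c : 'rV[R]_n.+1) :
  s *: (cons_rV (a, b) + c) =
  cons_rV (s * (a + c ord0 ord0), s *: (b + \row_j c ord0 (lift ord0 j))).
Proof.
apply/rowP => j; rewrite mxE [X in s * X]mxE.
by case: (unliftP ord0 j) => [k ->|->]; rewrite ?cons_rVS ?cons_rV0 ?mxE.
Qed.

(** Induction on the dimension by Tonelli: the one-dimensional rule scales the outer variable, the
    induction hypothesis the inner ones. *)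
Lemma ge0_integral_rV_affine n (s : R) (c : 'rV[R]_n) (s0 : 0 < s)
    (f : 'rV[R]_n -> \bar R) :
  measurable_fun [set: 'rV[R]_n] f -> (forall x, 0 <= f x)%E ->
  (\int[lebesgue_rV n]_x f x =
   (s ^+ n)%:E * \int[lebesgue_rV n]_x f (s *: (x + c))%R)%E.
Proof.
elim: n c f => [|n IH] c f mf f0.
  rewrite expr0 mul1e; apply: eq_integral => x _; congr f.
  by rewrite [LHS]thinmx0 [RHS]thinmx0.
have maff : measurable_fun setT (fun x : 'rV[R]_n.+1 => s *: (x + c)).
  apply: measurable_fun_rVP => i.
  under eq_fun do rewrite !mxE.
  apply: measurable_funM => //; apply: measurable_funD => //.
  exact: measurable_coord.
have maff' : measurable_fun setT (fun x : 'rV[R]_n.+1 => f (s *: (x + c))).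
  exact: measurableT_comp.
rewrite [in LHS]ge0_integral_rVS// [in RHS]ge0_integral_rVS//.
pose F a := (\int[lebesgue_rV n]_b f (cons_rV (a, b)))%E.
have mfc : measurable_fun setT (fun p => f (@cons_rV R n p)).
  by apply: measurableT_comp => //; exact: measurable_cons_rV.
have mF : measurable_fun [set: R] F.
  exact: (@measurable_fun_fubini_tonelli_F _ _ _ _ _ (lebesgue_rV n) _ mfc).
rewrite (@ge0_integral_affine s (c ord0 ord0))//; last first.
  by move=> a; apply: integral_ge0.
rewrite exprS EFinM -muleA; congr (_ * _)%E.
rewrite -ge0_integralZl//; first last.
- by rewrite lee_fin exprn_ge0// ltW.
- by move=> *; apply: integral_ge0.
- apply: (@measurable_fun_fubini_tonelli_F _ _ _ _ _ (lebesgue_rV n) (fun p => f (s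
    *: (cons_rV p + c)))) => //.
  by apply: (measurableT_comp maff'); exact: measurable_cons_rV.
apply: eq_integral => a _; rewrite /F.
rewrite (IH (\row_j c ord0 (lift ord0 j)))//; last first.
  exact: (measurable_fun_pair2 (s * (a + c ord0 ord0)) mfc).
by congr (_ * _)%E; apply: eq_integral => b _; rewrite cons_rV_affine.
Qed.

(** Serves to evaluate the convolution in [pou], whose integrand is a product over the
    coordinates. *)
Lemma ge0_integral_rV_prod n (h : 'I_n -> R -> R) :
  (forall i, measurable_fun [set: R] (h i)) -> (forall i x, 0 <= h i x) ->
  (\int[lebesgue_rV n]_x (\prod_(i < n) h i (x ord0 i))%:E =
   \prod_(i < n) \int[mu]_t (h i t)%:E)%E.
Proof.
elim: n h => [|n IH] h mh h0.
  rewrite big_ord0; under eq_integral do rewrite big_ord0.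
  by rewrite integral_dirac//= diracT mul1e.
have mp m (k : 'I_m -> R -> R) : (forall i, measurable_fun [set: R] (k i)) ->
    measurable_fun [set: 'rV[R]_m] (fun x => (\prod_(i < m) k i (x ord0 i))%:E).
  move=> mk; apply/measurable_EFinP; apply: measurable_prod => i _.
  exact: (measurableT_comp (mk i) (@measurable_coord R m i)).
have p0 (s : 'rV[R]_n) : 0 <= \prod_(i < n) h (lift ord0 i) (s ord0 i).
  by apply: prodr_ge0 => i _.
rewrite ge0_integral_rVS; [|exact: mp|by move=> x; rewrite lee_fin prodr_ge0].
have mh0 : measurable_fun [set: R] (EFin \o h ord0) by exact/measurable_EFinP.
rewrite big_ord_recl -IH//.
rewrite -ge0_integralZr//; first last.
- by apply: integral_ge0 => x _; rewrite lee_fin.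
- by move=> x _; rewrite lee_fin.
apply: eq_integral => a _.
rewrite -ge0_integralZl//; first last.
- by rewrite lee_fin.
- by move=> x _; rewrite lee_fin.
- by apply: (mp n (fun i => h (lift ord0 i))).
apply: eq_integral => b _; rewrite big_ord_recl cons_rV0 EFinM; congr (_ * EFin _)%E.
by apply: eq_bigr => i _; rewrite cons_rVS.
Qed.

End measure.

(** * Borel sets of row vectors *)

Section topology.
Context {R : realType}.

Lemma nbhs_rVP n (x : 'rV[R]_n) (A : set 'rV[R]_n) : nbhs x A ->
  exists2 e : R, 0 < e &
    forall y : 'rV[R]_n, (forall l, `|y ord0 l - x ord0 l| < e) -> A y.
Proof.
move=> /nbhs_ballP[e /= e0 xA]; exists e => // y xy; apply: xA.
by split=> // i j; rewrite ord1; apply: le_lt_trans (xy j); rewrite distrC.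
Qed.

(** Half-open, unlike [element], so that every point lies in some cell of each mesh size. *)
Definition cell {n} (s : R) (i : 'rV[int]_n) : set 'rV[R]_n :=
  [set x | forall l, (i ord0 l)%:~R * s <= x ord0 l < ((i ord0 l)%:~R + 1) * s].

Lemma measurable_cell n (s : R) (i : 'rV[int]_n) : measurable (cell s i).
Proof.
rewrite (_ : cell s i = [set x : 'rV[R]_n | forall l,
   `[(i ord0 l)%:~R * s, ((i ord0 l)%:~R + 1) * s[%classic (x ord0 l)]).
  apply: (@measurable_box R n (fun l => `[(i ord0 l)%:~R * s, ((i ord0 l)%:~R + 1)
    * s[%classic)) => l.
  exact: measurable_itv.
by apply/seteqP; split => x /= xi l; have := xi l; rewrite in_itv.
Qed.

Lemma in_cell_floor n (s : R) (x : 'rV[R]_n) : 0 < s ->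
  cell s (\row_l Num.floor (x ord0 l / s)) x.
Proof.
move=> s0 l; rewrite mxE.
have /andP[h1 h2] := floor_itv (x ord0 l / s).
by rewrite -ler_pdivlMr// h1/= -ltr_pdivrMr// (lt_le_trans h2)// intrD.
Qed.

(** An open set is the countable union of the cells of mesh size 1/(N+1), N a natural number, that
    it contains. *)
Lemma open_measurable_rV n (A : set 'rV[R]_n) : open A -> measurable A.
Proof.
move=> oA.
pose F (p : 'rV[int]_n * nat) : set 'rV[R]_n :=
  [set x | cell (p.2.+1%:R^-1) p.1 `<=` A /\ cell (p.2.+1%:R^-1) p.1 x].
rewrite (_ : A = \bigcup_p F p).
  apply: countable_bigcupT_measurable => // p.
  have [sA|nA] := pselect (cell (p.2.+1%:R^-1) p.1 `<=` A).
    rewrite (_ : F p = cell (p.2.+1%:R^-1) p.1); first exact: measurable_cell.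
    by apply/seteqP; split=> x // [].
  by rewrite (_ : F p = set0) //; apply/seteqP; split=> x // [].
apply/seteqP; split=> [x Ax|x [p _] [+ px]]; last exact.
have [e e0 xA] := nbhs_rVP (open_nbhs_nbhs (conj oA Ax)).
have [N _ /(_ N (leqnn N)) /= Ne] := near_infty_natSinv_lt (PosNum e0).
have s0 : 0 < N.+1%:R^-1 :> R by rewrite invr_gt0.
exists (\row_l Num.floor (x ord0 l / N.+1%:R^-1), N) => //.
split; last exact: in_cell_floor.
move=> y; have := in_cell_floor x s0; rewrite /cell/= => xc yc; apply: xA => l.
apply: le_lt_trans Ne.
have /andP[h1 h2] := xc l; have /andP[h3 h4] := yc l.
rewrite mulrDl mul1r in h2; rewrite mulrDl mul1r in h4.
have aux (c t a b : R) : c <= a -> a < c + t -> c <= b -> b < c + t -> `|b - a| <= t.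
  by move=> *; rewrite ler_norml; apply/andP; split; lra.
exact: aux h1 h2 h3 h4.
Qed.

End topology.

(** * Positive semidefinite forms *)

Section psd_forms.
Context {R : realType} {U : lmodType R}.

Definition psd_form (a : U -> U -> R) := [/\ forall u v, a u v = a v u,
  forall c u v w, a (c *: u + v) w = c * a u w + a v w & forall v, 0 <= a v v].

Section theory.
Variable a : U -> U -> R.
Hypothesis apsd : psd_form a.

Lemma psd_formC u v : a u v = a v u. Proof. by case: apsd. Qed.

Lemma psd_form_ge0 v : 0 <= a v v. Proof. by case: apsd. Qed.

Lemma psd_formDl u v w : a (u + v) w = a u w + a v w.
Proof. by case: apsd => _ /(_ 1 u v w) + _; rewrite scale1r mul1r. Qed.

Lemma psd_form0l w : a 0 w = 0.
Proof. by have := psd_formDl 0 0 w; rewrite addr0; lra. Qed.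

Lemma psd_formZl c u w : a (c *: u) w = c * a u w.
Proof. by case: apsd => _ /(_ c u 0 w) + _; rewrite addr0 psd_form0l addr0. Qed.

Lemma psd_formDr w u v : a w (u + v) = a w u + a w v.
Proof. by rewrite psd_formC psd_formDl !(psd_formC _ w). Qed.

Lemma psd_formZr c u w : a w (c *: u) = c * a w u.
Proof. by rewrite psd_formC psd_formZl psd_formC. Qed.

Lemma psd_form_sqrDZ u t v :
  a (t *: u + v) (t *: u + v) = t ^+ 2 * a u u + 2 * t * a u v + a v v.
Proof.
rewrite !(psd_formDl, psd_formDr, psd_formZl, psd_formZr) (psd_formC v u); ring.
Qed.

Lemma psd_form_eq0 u v : a u u = 0 -> a u v = 0.
Proof.
move=> u0; apply/eqP/negP => /negP uv0.
(* As [a u u = 0], the form at t u + v is affine in t; for this t its value is -1. *)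
have := psd_form_ge0 (- ((a v v + 1) / (2 * a u v)) *: u + v).
rewrite psd_form_sqrDZ u0 mulr0 add0r.
have -> : 2 * - ((a v v + 1) / (2 * a u v)) * a u v = - (a v v + 1) by field.
lra.
Qed.

Lemma psd_formD_le u v : a (u + v) (u + v) <= 2 * a u u + 2 * a v v.
Proof.
have := psd_form_ge0 (-1 *: u + v); have := psd_form_sqrDZ u (-1) v.
have := psd_form_sqrDZ u 1 v; rewrite scale1r; lra.
Qed.

End theory.

(* Induction on the number of generators: the first generator is split off
   orthogonally with respect to [a]. *)
Lemma psd_form_dominated (a b : U -> U -> R) : psd_form a -> psd_form b ->
  forall n (e : 'I_n -> U),
  (forall c : 'I_n -> R, let v := \sum_i c i *: e i in a v v = 0 -> b v v = 0) ->
  exists2 C : R, 0 <= C &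
    forall c : 'I_n -> R, let v := \sum_i c i *: e i in b v v <= C * a v v.
Proof.
move=> pa pb; elim=> [|n IH] e ker.
  exists 0 => // c /=; rewrite !big_ord0.
  by rewrite (psd_form0l pb) mul0r.
have [a0|a0] := eqVneq (a (e ord0) (e ord0)) 0.
  have b0 : b (e ord0) (e ord0) = 0.
    have := ker (fun i => (i == ord0)%:R); rewrite big_ord_recl eqxx scale1r big1
      => [|i _].
      by rewrite addr0; exact.
    by rewrite scale0r.
  have ext c (t := c ord0) (v := \sum_(i < n) c (lift ord0 i) *: e (lift ord0 i)) f :
      psd_form f -> f (e ord0) (e ord0) = 0 ->
      f (\sum_i c i *: e i) (\sum_i c i *: e i) = f v v.
    move=> pf f0; rewrite big_ord_recl -/v (psd_form_sqrDZ pf) f0.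
    by rewrite (psd_form_eq0 pf v f0) !mulr0 !add0r.
  have [|C C0 IC] := IH (fun i => e (lift ord0 i)).
    move=> c; have := ker (fun i => if unlift ord0 i is Some j then c j else 0).
    rewrite /= !ext//=; under eq_bigr do rewrite liftK.
    by [].
  by exists C => // c /=; rewrite !ext//; exact: IC.
have agt0 : 0 < a (e ord0) (e ord0) by rewrite lt_def a0 (psd_form_ge0 pa).
(* Gram-Schmidt: [e' i] is the part of the generator [a]-orthogonal to [e ord0]; [p c] collects the
   subtracted coefficients. *)
pose e' i := e (lift ord0 i) - (a (e ord0) (e (lift ord0 i)) / a (e ord0) (e ord0))
  *: e ord0.
pose p (c : 'I_n -> R) := \sum_i c i * (a (e ord0) (e (lift ord0 i)) / a (e ord0)
  (e ord0)).
have sume' c : \sum_i c i *: e' i = (- p c) *: e ord0 + \sum_i c i *: e (lift ord0 i).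
  rewrite /p scaleNr scaler_suml [RHS]addrC -sumrB; apply: eq_bigr => i _.
  by rewrite scalerBr scalerA.
have orth c : a (e ord0) (\sum_i c i *: e' i) = 0.
  elim/big_ind: _ => [|u v hu hv|i _].
  - by rewrite (psd_formC pa) (psd_form0l pa).
  - by rewrite (psd_formDr pa) hu hv addr0.
  - rewrite (psd_formZr pa) /e' -scaleNr (psd_formDr pa) (psd_formZr pa).
    by field.
have dec (c : 'I_n.+1 -> R) (c' := fun i => c (lift ord0 i)) :
   \sum_i c i *: e i = (c ord0 + p c') *: e ord0 + \sum_i c' i *: e' i.
  by rewrite sume' addrA -scalerDl addrK big_ord_recl.
have [|C C0 IC] := IH e'.
  (* The coefficient [- p c] of [e ord0] makes the combination equal to the sum of the
     [c i *: e' i]. *)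
  move=> c; have := ker (fun i => if unlift ord0 i is Some j then c j else - p c).
  rewrite dec /= unlift_none.
  have -> : (fun i => if unlift ord0 (lift ord0 i) is Some j then c j else - p c) = c.
    by apply/funext => i; rewrite liftK.
  by rewrite addNr scale0r add0r; under eq_bigr do rewrite liftK.
(* The factors 2 come from [psd_formD_le], C from the orthogonal part, and the quotient compares the
   two forms on [e ord0]. *)
exists (2 * C + 2 * (b (e ord0) (e ord0) / a (e ord0) (e ord0))).
  by rewrite addr_ge0// mulr_ge0// divr_ge0// psd_form_ge0.
move=> c /=; rewrite dec; set t := _ + p _; set v := \sum_i _ *: e' i.
have := psd_formD_le pb (t *: e ord0) v.
rewrite (psd_formZl pb) (psd_formZr pb) => h; apply: le_trans h _.
rewrite (psd_form_sqrDZ pa) orth mulr0 addr0.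
have : b v v <= C * a v v by apply: IC.
have hv := psd_form_ge0 pa v.
set A := a _ _ in agt0 *; set B := b (e ord0) _; set V := a v v in hv * => bv.
have B0 : 0 <= B / A by rewrite divr_ge0 ?(psd_form_ge0 pb)// ltW.
have : 2 * (t * (t * B)) = 2 * (B / A) * (t ^+ 2 * A) by field; rewrite gt_eqF.
have : 0 <= C * (t ^+ 2 * A) by rewrite mulr_ge0// mulr_ge0 ?sqr_ge0// ltW.
have : 0 <= (B / A) * V by rewrite mulr_ge0.
nra.
Qed.

End psd_forms.

(** * Smooth functions of one variable *)

Section smooth.
Context {R : realType}.
Implicit Types (f g h : R -> R) (n : nat).

(** Carrying the derivative as a witness lets the closure properties go by induction on n, with no
    formula for higher derivatives of products and compositions. *)
Fixpoint smooth_upto n h := if n is m.+1 then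
  exists2 h' : R -> R, (forall x : R, is_derive x 1 h (h' x)) & smooth_upto m h'
    else True.

Definition smooth h := forall n, smooth_upto n h.

Lemma smooth_uptoS n h : smooth_upto n.+1 h -> smooth_upto n h.
Proof.
by elim: n h => [//|n IH] h [h' dh sh]; exists h' => //; exact: IH.
Qed.

Lemma smooth_derive1P h : smooth h ->
  (forall x : R, is_derive x 1 h (derive1 h x)) /\ smooth (derive1 h).
Proof.
move=> sh; have dh (x : R) : is_derive x 1 h (derive1 h x).
  have [h' dh' _] := sh 1%N; rewrite derive1E.
  by have ? := dh' x; rewrite derive_val.
split=> // n; have [h' dh' sn] := sh n.+1.
rewrite (_ : (derive1 h) = h')//; apply/funext => x; rewrite derive1E.
by have ? := dh' x; rewrite derive_val.
Qed.

Lemma smooth_derive1n h n : smooth h -> smooth (derive1n n h).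
Proof. by move=> sh; elim: n => // n IH; case: (smooth_derive1P IH). Qed.

Lemma smooth_is_derive h (x : R) : smooth h -> is_derive x 1 h (derive1 h x).
Proof. by move=> /smooth_derive1P[]. Qed.

Lemma smooth_continuous h : smooth h -> continuous h.
Proof.
move=> sh x; apply/differentiable_continuous/derivable1_diffP.
by have [] := smooth_is_derive x sh.
Qed.

Lemma smooth_cst (c : R) : smooth (cst c).
Proof.
move=> n; elim: n c => // n IH c; exists (cst 0) => // x.
exact: is_derive_cst.
Qed.

Lemma smooth_uptoD n f g : smooth_upto n f -> smooth_upto n g ->
  smooth_upto n (fun x => f x + g x).
Proof.
elim: n f g => // n IH f g [f' df nf] [g' dg ng].
exists (fun x => f' x + g' x); last exact: IH.
by move=> x; have ? := df x; have ? := dg x; apply: is_deriveD.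
Qed.

Lemma smooth_uptoM n f g : smooth_upto n f -> smooth_upto n g ->
  smooth_upto n (fun x => f x * g x).
Proof.
elim: n f g => // n IH f g sf sg; have := sf; have := sg.
move=> [g' dg ng] [f' df nf].
exists (fun x => f x * g' x + g x * f' x).
  by move=> x; have ? := df x; have ? := dg x; apply: is_deriveM.
by apply: smooth_uptoD; apply: IH => //; exact: smooth_uptoS.
Qed.

Lemma smooth_upto_comp n f g : smooth_upto n f -> smooth_upto n g ->
  smooth_upto n (f \o g).
Proof.
elim: n f g => // n IH f g sf sg; have := sf; have := sg.
move=> [g' dg ng] [f' df nf].
exists (fun x => (f' \o g) x * g' x).
  by move=> x; have ? := df (g x); have ? := dg x; apply: is_derive1_comp.
by apply: smooth_uptoM => //; apply: IH => //; exact: smooth_uptoS.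
Qed.

Lemma smoothD f g : smooth f -> smooth g -> smooth (fun x => f x + g x).
Proof. by move=> sf sg n; exact: smooth_uptoD. Qed.

Lemma smoothM f g : smooth f -> smooth g -> smooth (fun x => f x * g x).
Proof. by move=> sf sg n; exact: smooth_uptoM. Qed.

Lemma smooth_comp f g : smooth f -> smooth g -> smooth (f \o g).
Proof. by move=> sf sg n; exact: smooth_upto_comp. Qed.

Lemma smooth_poly (p : {poly R}) : smooth (horner p).
Proof.
move=> n; elim: n p => // n IH p; exists (horner p^`()) => // x.
exact: is_derive_poly.
Qed.

Lemma smooth_id : smooth id.
Proof.
by rewrite (_ : id = horner 'X); [exact: smooth_poly|apply/funext => x; rewrite
  hornerX].
Qed.

Lemma smooth_primitive f g : smooth f -> (forall x : R, is_derive x 1 g (f x)) ->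
  smooth g.
Proof. by move=> sf dg [//|n]; exists f. Qed.

(* The functions p(1/x) exp(-1/x), cut off at 0, form a family stable under
   derivation: the derivative turns p into X^2 (p - p'). *)
Definition flat (p : {poly R}) (x : R) : R :=
  if 0 < x then p.[x^-1] * expR (- x^-1) else 0.

(** With y = 1/x >= 1 and N = [size p], |p(y)| is at most a multiple of y^N, while exp(y) >=
    y^(N+2)/(N+2)!. The two spare powers give x^2, which is what the derivative at 0 requires. *)
Lemma flat_le (p : {poly R}) : exists2 M : R, 0 <= M &
  forall x, `|x| <= 1 -> `|flat p x| <= M * x ^+ 2.
Proof.
pose N := size p; pose S := \sum_(i < N) `|p`_i|.
have S0 : 0 <= S by apply: sumr_ge0.
exists (S * (N.+2)`!%:R); first exact: mulr_ge0.
move=> x x1; rewrite /flat; case: ifPn => x0; last first.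
  by rewrite normr0 mulr_ge0 ?sqr_ge0// mulr_ge0.
have y1 : 1 <= x^-1 by rewrite invf_ge1// (le_trans (ler_norm _)).
have y0 : 0 <= x^-1 by rewrite (le_trans _ y1).
rewrite normrM (ger0_norm (expR_ge0 _)).
have pS : `|p.[x^-1]| <= S * x^-1 ^+ N.
  rewrite horner_coef (le_trans (ler_norm_sum _ _ _))// mulr_suml ler_sum// => i _.
  rewrite normrM ler_wpM2l// normrX (ger0_norm y0) ler_weXn2l//.
  by rewrite ltnW.
have eS : expR (- x^-1) * x^-1 ^+ N.+2 <= (N.+2)`!%:R.
  rewrite expRN mulrC ler_pdivrMr ?expR_gt0// -ler_pdivrMl ?ltr0n ?fact_gt0//.
  by rewrite mulrC (le_trans _ (expR_ge1Dxn N.+1 y0))// lerDr.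
apply: le_trans (ler_wpM2r (expR_ge0 _) pS) _.
rewrite -!mulrA ler_wpM2l// mulrC -ler_pdivrMr ?exprn_gt0// -exprVn -mulrA -exprD.
by rewrite addn2.
Qed.

Lemma is_derive_flat (p : {poly R}) (x : R) :
  is_derive x 1 (flat p) (flat ('X^2 * (p - p^`())) x).
Proof.
have [x0|x0|->] := ltgtP x 0.
- rewrite {2}/flat ltNge (ltW x0)/=.
  apply: (@near_eq_is_derive _ _ _ (cst 0)).
  near=> y; rewrite /flat ltNge (ltW (_ : y < 0))//.
  by near: y; exact: lt_nbhsl.
- rewrite {2}/flat x0.
  pose F (y : R) := p.[y^-1] * expR (- y^-1).
  apply: (@near_eq_is_derive _ _ _ F).
    near=> y; rewrite /flat /F (_ : 0 < y)//.
    by near: y; exact: lt_nbhsr.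
  have dV : is_derive x 1 (fun y : R => y^-1) (- x ^- 2).
    apply: DeriveDef; first by apply: derivableV; rewrite ?gt_eqF.
    by rewrite deriveV ?gt_eqF// derive_id scaler1.
  have dN : is_derive x 1 (fun y : R => - y^-1) (- - x ^- 2) by apply: is_deriveN.
  have d1 := @is_derive1_comp _ (horner p) GRing.inv x _ _ (is_derive_poly p x^-1) dV.
  have d2 := @is_derive1_comp _ expR (fun y => - y^-1) x _ _ (is_derive_expR (-
    x^-1)) dN.
  have := is_deriveM d1 d2.
  move/is_derive_eq; apply.
  rewrite !hornerE /= /GRing.scale/= exprVn; ring.
- rewrite {2}/flat ltxx.
  have [M M0 fM] := flat_le p.
  have f0 : flat p 0 = 0 by rewrite /flat ltxx.
  (* By [flat_le] the difference quotient at 0 is at most M |h|; below, M + 1 replaces M because M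
     may be 0. *)
  have cv : h^-1 *: (flat p (h *: 1 + 0) - flat p 0) @[h --> 0^'] --> (0 : R).
    rewrite f0; under eq_fun do rewrite addr0 subr0 [_ *: 1]mulr1.
    apply/cvgr0Pnorm_le => e e0; near=> h.
    have h0 : h != 0 by near: h; exact: nbhs_dnbhs_neq.
    have h1 : `|h| <= 1 by near: h; apply: dnbhs0_le.
    have hM : `|h| <= e / (M + 1).
      by near: h; apply: dnbhs0_le; rewrite divr_gt0// ltr_wpDl.
    rewrite normrZ normfV ler_pdivrMl ?normr_gt0// (le_trans (fM _ h1))//.
    rewrite -(real_normK (num_real h)) expr2 mulrCA ler_wpM2l//.
    have M1 : 0 < M + 1 by rewrite ltr_wpDl.
    rewrite ler_pdivlMr// in hM; rewrite mulrC (le_trans _ hM)//.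
    by rewrite ler_wpM2l// lerDl.
  apply: DeriveDef; first by apply/cvg_ex; exists 0.
  exact/cvg_lim.
Unshelve. all: by end_near. Qed.

Lemma smooth_flat p : smooth (flat p).
Proof.
move=> n; elim: n p => // n IH p.
by exists (flat ('X^2 * (p - p^`()))) => // x; exact: is_derive_flat.
Qed.

(** The condition |x| < 1/2 is positivity of 1 - 4 x^2, so the cutoff of [bump] is that of
    [flat]. *)
Lemma bumpE : (Defs.bump : R -> R) = flat 1 \o horner (1 - 4 *: 'X^2).
Proof.
apply/funext => x; rewrite /Defs.bump /flat/= -polyC1 hornerC mul1r.
have -> : (1%:P - 4 *: 'X^2).[x] = 1 - 4 * x ^+ 2 by rewrite !hornerE /=; ring.
suff -> : (`|x| < 2^-1) = (0 < 1 - 4 * x ^+ 2) by [].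
rewrite -(ltr_pXn2r (ltn0Sn 1)) ?nnegrE// real_normK ?num_real//.
by apply/idP/idP; lra.
Qed.

Lemma smooth_bump : smooth (Defs.bump : R -> R).
Proof.
by rewrite bumpE; apply: smooth_comp; [exact: smooth_flat|exact: smooth_poly].
Qed.

End smooth.

(** * The partition of unity as a tensor product *)

Section pou_tensor.
Context {R : realType}.
Local Notation mu := (@lebesgue_measure R).

Lemma integral_is_derive (f F : R -> R) (a b : R) : a < b -> continuous f ->
  (forall x : R, is_derive x 1 F (f x)) ->
  (\int[mu]_(x in `[a, b]) (f x)%:E = (F b - F a)%:E)%E.
Proof.
move=> ab cf dF; have cF : continuous F.
  by move=> x; apply/differentiable_continuous/derivable1_diffP; have [] := dF x.
rewrite (continuous_FTC2 ab _ (F := F)) ?EFinB//.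
- exact: continuous_subspaceT.
- split=> [x _||]; first by have [] := dF x.
  + by apply: cvg_at_right_filter; exact: cF.
  + by apply: cvg_at_left_filter; exact: cF.
- by move=> x _; rewrite derive1E; have ? := dF x; rewrite derive_val.
Qed.

Lemma zeta1_ge0 (x : R) : 0 <= zeta1 x.
Proof.
have b0 (y : R) : 0 <= Defs.bump y by rewrite /Defs.bump; case: ifP => // _; exact:
  expR_ge0.
by rewrite mulr_ge0// invr_ge0 Rintegral_ge0.
Qed.

Lemma zeta1_eq0 (x : R) : 2^-1 <= `|x| -> zeta1 x = 0.
Proof. by move=> x2; rewrite /zeta1 /Defs.bump ltNge x2/= mulr0. Qed.

Lemma smooth_zeta1 : smooth (zeta1 : R -> R).
Proof. by apply: smoothM; [exact: smooth_cst|exact: smooth_bump]. Qed.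

(** The integral starts at -1, to the left of the support: the fundamental theorem applies for x >
    -1, and near any x <= -1 the primitive is 0. *)
Lemma zeta1_primitive : exists Z : R -> R, forall x : R, is_derive x 1 Z (zeta1 x).
Proof.
have cz := smooth_continuous smooth_zeta1.
exists (fun x => \int[mu]_(t in `[- 1, x]) zeta1 t)%R => x.
have [x1|x1] := ltP (- 1) x.
  have [||d <-] := @continuous_FTC1_closed _ (zeta1 : R -> R) (- 1) x (x + 1) _ _
    x1 (cz x).
  - by rewrite ltrDl.
  - apply: continuous_compact_integrable; first exact: segment_compact.
    exact: continuous_subspaceT.
  - by rewrite derive1E; exact: derivableP.
rewrite zeta1_eq0; last by rewrite ler0_norm; lra.
apply: (@near_eq_is_derive _ _ _ (cst 0)).
near=> y; rewrite /Rintegral integral0_eq// => t /=; rewrite in_itv/= => /andP[_ ty].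
have y2 : y < - 2^-1 by near: y; apply: lt_nbhsl; lra.
by rewrite zeta1_eq0// ler0_norm; lra.
Unshelve. all: by end_near. Qed.

Definition hat_primitive : R -> R := sval (cid zeta1_primitive).

Lemma is_derive_hat_primitive (x : R) : is_derive x 1 hat_primitive (zeta1 x).
Proof. by rewrite /hat_primitive; case: cid. Qed.

(* The one-dimensional factor of [pou]: the convolution of [zeta1] with the
   indicator of the interval of length 1 around 0. *)
Definition hat (t : R) : R := hat_primitive (t + 2^-1) - hat_primitive (t - 2^-1).

Lemma smooth_shift (f : R -> R) (c : R) : smooth f -> smooth (fun t => f (t + c)).
Proof.
move=> sf; apply: (@smooth_comp _ f (fun t => t + c)) => //.
by apply: smoothD; [exact: smooth_id|exact: smooth_cst].
Qed.

Lemma smooth_hat : smooth hat.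
Proof.
have sZ : smooth hat_primitive.
  exact: (smooth_primitive smooth_zeta1 is_derive_hat_primitive).
rewrite (_ : hat = fun t => hat_primitive (t + 2^-1) + cst (-1) t * hat_primitive
  (t - 2^-1)).
  apply: smoothD; first exact: smooth_shift.
  by apply: smoothM; [exact: smooth_cst|exact: smooth_shift].
by apply/funext => t; rewrite mulN1r.
Qed.

(** [hat t] is the integral of [zeta1] over the interval of length 1 around t, which for |t| >= 1
    stays outside the open support. *)
Lemma hat_eq0 (t : R) : 1 <= `|t| -> hat t = 0.
Proof.
move=> t1; have ab : t - 2^-1 < t + 2^-1 by lra.
have := integral_is_derive ab (smooth_continuous smooth_zeta1) is_derive_hat_primitive.
rewrite integral0_eq => [[e]|y /=]; first by rewrite /hat -e.
rewrite in_itv/= => /andP[h1 h2].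
rewrite zeta1_eq0//; move: t1; rewrite !ler_normr => /orP[h|h].
  by apply/orP; left; lra.
by apply/orP; right; lra.
Qed.

(** The factor of the convolution in one coordinate. [F] is an antiderivative of the kernel in t,
    and its boundary values are the two terms of [hat]. *)
Lemma integral_core1 (s x c : R) : 0 < s ->
  (\int[mu]_t (\1_(`](c - 2^-1) * s, (c + 2^-1) * s[) t *
     (s^-1 * zeta1 (s^-1 * (x - t))))%:E = (hat (x / s - c))%:E)%E.
Proof.
move=> s0; set a := _ * s; set b := _ * s.
have ab : a < b by rewrite /a /b ltr_pM2r//; lra.
pose f t := s^-1 * zeta1 (s^-1 * (x - t)).
pose F t := - hat_primitive (s^-1 * (x - t)).
have dF (t : R) : is_derive t 1 F (f t).
  have d1 : is_derive t 1 (fun t : R => s^-1 * (x - t)) (- s^-1).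
    have := is_deriveZ s^-1 (is_deriveB (is_derive_cst x t 1) (is_derive_id t 1)).
    by move/is_derive_eq; apply; rewrite sub0r scalerN [_ *: _]mulr1.
  have := @is_derive1_comp _ hat_primitive (fun t : R => s^-1 * (x - t)) t _ _
    (is_derive_hat_primitive _) d1.
  move=> /(@is_deriveN _ _ _ _ _ _ _)/is_derive_eq; apply.
  by rewrite mulrN opprK mulrC.
have cf : continuous f.
  apply: smooth_continuous; apply: smoothM; first exact: smooth_cst.
  apply: (@smooth_comp _ zeta1 (fun t => s^-1 * (x - t))); first exact: smooth_zeta1.
  apply: smoothM; first exact: smooth_cst.
  apply: smoothD; first exact: smooth_cst.
  rewrite (_ : -%R = fun t => cst (-1) t * t); last by apply/funext => t; rewrite
    mulN1r.
  by apply: smoothM; [exact: smooth_cst|exact: smooth_id].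
transitivity (\int[mu]_(t in `]a, b[) (f t)%:E)%E.
  rewrite [RHS]integral_mkcond; apply: eq_integral => t _.
  rewrite patchE indicE; case: ifPn => tab; first by rewrite mul1r.
  by rewrite mul0r.
rewrite -(@integral_itv_bndoo _ _ _ _ true false); last first.
  by apply: measurable_funTS; apply/measurable_EFinP; exact: continuous_measurable_fun.
rewrite (integral_is_derive ab cf dF) /F opprK /hat; congr EFin.
rewrite [RHS]addrC; congr (- hat_primitive _ + hat_primitive _).
  by rewrite /b mulrBr mulrC; field; rewrite gt_eqF.
by rewrite /a mulrBr mulrC; field; rewrite gt_eqF.
Qed.

(** The indicator of the core and the kernel both factor over the coordinates, the weight s^(-d)
    contributing one 1/s to each factor [h l]. *)
Lemma pouE d (s : R) (i : 'rV[int]_d) (x : 'rV[R]_d) : 0 < s ->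
  pou s i x = \prod_(l < d) hat (x ord0 l / s - (i ord0 l)%:~R).
Proof.
move=> s0; rewrite /pou /convolution.
pose h (l : 'I_d) (t : R) :=
  \1_(`]((i ord0 l)%:~R - 2^-1) * s, ((i ord0 l)%:~R + 2^-1) * s[) t *
  (s^-1 * zeta1 (s^-1 * (x ord0 l - t))).
have mh l : measurable_fun [set: R] (h l).
  apply: measurable_funM; first by apply: measurable_indic; exact: measurable_itv.
  apply: measurable_funM => //; apply: (measurableT_comp (f := zeta1)).
    apply: continuous_measurable_fun; exact/smooth_continuous/smooth_zeta1.
  by apply: measurable_funM => //; exact: measurable_funB.
have h0 l t : 0 <= h l t.
  by rewrite mulr_ge0// mulr_ge0 ?zeta1_ge0// invr_ge0 ltW.
rewrite /Rintegral (eq_integral (fun y : 'rV[R]_d => (\prod_(l < d) h l (y ord0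
  l))%:E)).
  rewrite ge0_integral_rV_prod//.
  under eq_bigr do rewrite integral_core1//.
  by rewrite -(@big_morph _ _ EFin 1%E *%E 1 *%R).
move=> y _; congr EFin; rewrite /h big_split; congr (_ * _) => /=.
  rewrite indicE; have [yi|yi] := boolP (y \in core s i).
    apply/esym/big1 => l _; rewrite indicE mem_set//=.
    by rewrite in_itv/=; exact: (set_mem yi).
  have /existsNP[l yl] : ~ forall l, ((i ord0 l)%:~R - 2^-1) * s < y ord0 l
                       < ((i ord0 l)%:~R + 2^-1) * s by move: yi; rewrite notin_setE.
  rewrite (bigD1 l)//= indicE memNset ?mul0r//=.
rewrite /zeta_scaled /zeta [RHS]big_split /=; congr (_ * _).
  by rewrite prodr_const card_ord exprVn.
by apply: eq_bigr => l _; rewrite !mxE.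
Qed.

End pou_tensor.

(** * Sums of tensor products *)

Section tensor.
Context {R : realType} {d : nat}.
Implicit Types (h : 'I_d -> R -> R) (x : 'rV[R]_d) (a : 'I_d -> nat).

Definition tensor h x : R := \prod_(l < d) h l (x ord0 l).

Definition derive_tensor a h : 'I_d -> R -> R := fun l => derive1n (a l) (h l).

Lemma smooth_derive_tensor a h : (forall l, smooth (h l)) ->
  forall l, smooth (derive_tensor a h l).
Proof. by move=> sh l; exact: smooth_derive1n. Qed.

Lemma continuous_tensor h : (forall l, smooth (h l)) -> continuous (tensor h).
Proof.
move=> sh; rewrite /tensor.
apply: (@continuous_big _ _ _ _ _ _ _ _ (fun l x => h l (x ord0 l))).
  exact: mul_continuous.
move=> l _ x; apply: (@continuous_comp _ _ _ (fun x => x ord0 l) (h l)).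
  exact: coord_continuous.
exact/smooth_continuous.
Qed.

Lemma is_derive_line (f : 'rV[R]_d -> R) x (v : 'rV[R]_d) (df : R) :
  is_derive (0 : R) 1 (fun t : R => f (t *: v + x)) df -> is_derive x v f df.
Proof.
move=> [df1 df2]; apply: DeriveDef; first by have [_] := @derivable1P _ _ _ f x v;
  apply.
rewrite -df2 /derive; set g1 := fun t : R => t^-1 *: _; set g2 := fun t : R => t^-1
  *: _.
suff -> : g1 = g2 by [].
apply/funext => t; rewrite /g1 /g2/=.
by rewrite addr0 scale0r add0r [t *: 1]mulr1.
Qed.

Lemma is_derive_tensor h (k : 'I_d) x : (forall l, smooth (h l)) ->
  is_derive x (delta_mx ord0 k) (tensor h)
    (tensor (derive_tensor (fun l => (l == k)%N : nat) h) x).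
Proof.
move=> sh; apply: is_derive_line.
pose c := \prod_(l < d | l != k) h l (x ord0 l).
rewrite (_ : (fun t => _) = fun t => c * h k (t + x ord0 k)); last first.
  apply/funext => t; rewrite /tensor (bigD1 k)//= !mxE !eqxx mulr1 mulrC; congr (_ * _).
  by apply: eq_bigr => l lk; rewrite !mxE (negbTE lk) andbF mulr0 add0r.
have -> : tensor (derive_tensor (fun l => (l == k)%N : nat) h) x = c * derive1 (h
  k) (x ord0 k).
  rewrite /tensor (bigD1 k)//= mulrC /derive_tensor eqxx; congr (_ * _).
  by apply: eq_bigr => l lk; rewrite (negbTE lk).
have dk : is_derive (0 + x ord0 k) 1 (h k) (derive1 (h k) (x ord0 k)).
  by rewrite add0r; exact: smooth_is_derive.
have ds : is_derive (0 : R) 1 (fun t : R => t + x ord0 k) 1.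
  by have := is_derive_shift (0 : R) 1 (x ord0 k).
have := is_deriveZ c (@is_derive1_comp _ (h k) (fun t => t + x ord0 k) 0 _ _ dk ds).
by move/is_derive_eq; apply; rewrite mulr1.
Qed.

Definition tensor_sum {I : Type} (r : seq I) (c : I -> R) (h : I -> 'I_d -> R -> R)
  x : R :=
  \sum_(t <- r) c t * tensor (h t) x.

Section sums.
Context {I : Type}.
Implicit Types (r : seq I) (c : I -> R) (H : I -> 'I_d -> R -> R).

Lemma continuous_tensor_sum r c H : (forall t l, smooth (H t l)) ->
  continuous (tensor_sum r c H).
Proof.
move=> sh; rewrite /tensor_sum.
apply: (@continuous_big _ _ _ _ _ _ _ _ (fun t x => c t * tensor (H t) x)).
  exact: add_continuous.
move=> t _ x; apply: (@continuousM _ _ (cst (c t)) (tensor (H t)) x); last exact: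
  continuous_tensor.
exact: cst_continuous.
Qed.

Lemma is_derive_tensor_sum r c H (k : 'I_d) x : (forall t l, smooth (H t l)) ->
  is_derive x (delta_mx ord0 k) (tensor_sum r c H)
    (tensor_sum r c (fun t => derive_tensor (fun l => (l == k)%N : nat) (H t)) x).
Proof.
move=> sh; elim: r => [|t r IH].
  rewrite (_ : tensor_sum [::] c H = cst 0); last first.
    by apply/funext => y; rewrite /tensor_sum big_nil.
  by rewrite /tensor_sum big_nil; exact: is_derive_cst.
rewrite (_ : tensor_sum (t :: r) c H = c t *: tensor (H t) + tensor_sum r c H);
  last first.
  by apply/funext => y; rewrite /tensor_sum big_cons.
rewrite /tensor_sum big_cons.
apply: is_deriveD; apply: is_deriveZ.
exact: is_derive_tensor.
Qed.

Lemma partial_tensor_sum a r c H : (forall t l, smooth (H t l)) ->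
  partial a (tensor_sum r c H) = tensor_sum r c (fun t => derive_tensor a (H t)).
Proof.
move=> sh; rewrite /partial.
(* The induction runs over the list that [partial] folds, so the exponents are masked outside that
   list. Uniqueness of its entries ensures that the coordinate at the head has not yet been
   differentiated. *)
have -> : derive_tensor a = derive_tensor (fun l => if l \in enum 'I_d then a l
  else 0%N).
  by apply/funext => h; apply/funext => l; rewrite /derive_tensor mem_enum.
elim: (enum 'I_d) (enum_uniq 'I_d) => [_|k s IH /= /andP[ks us]]; first by [].
rewrite IH//.
have -> : (fun t => derive_tensor (fun l => if l \in k :: s then a l else 0%N) (H t)) =
  (fun t => derive_tensor (fun l => if l == k then a k else if l \in s then a l
    else 0%N) (H t)).
  apply/funext => t; apply/funext => l; rewrite /derive_tensor inE.
  by have [->|] := eqVneq l k.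
elim: (a k) => [|m IHm].
  rewrite /=; congr tensor_sum; apply/funext => t; apply/funext => l.
  by rewrite /derive_tensor; have [->|//] := eqVneq l k; rewrite (negbTE ks).
rewrite /= {}IHm; apply/funext => x.
have ? := is_derive_tensor_sum r c k x (fun t => smooth_derive_tensor _ (sh t)).
rewrite derive_val; congr tensor_sum.
apply/funext => t; apply/funext => l; rewrite /derive_tensor.
by have [//|] := eqVneq l k.
Qed.

End sums.

(** Allows a function known only on an open set, such as u on the fictitious domain or a reference
    combination on one element, to be differentiated there. *)
Lemma partial_local a (V : set 'rV[R]_d) (f g : 'rV[R]_d -> R) : open V ->
  (forall x, V x -> f x = g x) -> forall x, V x -> partial a f x = partial a g x.
Proof.
move=> oV; rewrite /partial; elim: (enum 'I_d) => //= k s IH fg.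
elim: (a k) => [|m IHm]; first exact: IH.
move=> x Vx /=; apply: near_eq_derive.
have : nbhs x V by exact: open_nbhs_nbhs.
by apply: filterS => y Vy; exact: IHm.
Qed.

Lemma continuous_measurable_rV (f : 'rV[R]_d -> R) : continuous f ->
  measurable_fun [set: 'rV[R]_d] f.
Proof.
move=> cf; apply: (measurability _ (RGenOpens.measurableE R)) => _ [_ [a [b ->] <-]].
rewrite setTI; apply: open_measurable_rV.
by apply: open_comp => // *; exact: cf.
Qed.

End tensor.

(** * Integrals over elements *)

Section elements.
Context {R : realType} {d : nat}.
Implicit Types (s : R) (i : 'rV[int]_d) (f g : 'rV[R]_d -> R).
Local Notation mu := (lebesgue_rV d).

Definition open_box (a b : 'I_d -> R) : set 'rV[R]_d :=
  [set x | forall l, `]a l, b l[%classic (x ord0 l)].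

Lemma elementE s i : element s i =
  open_box (fun l => (i ord0 l)%:~R * s) (fun l => ((i ord0 l)%:~R + 1) * s).
Proof.
apply/seteqP; split=> x xi; rewrite /open_box /element/= in xi *.
  by move=> l; rewrite in_itv; exact: xi.
by move=> l; have := xi l; rewrite in_itv.
Qed.

Lemma open_open_box a b : open (open_box a b).
Proof.
rewrite openE => x xab; exists (fun _ l => `]a l, b l[%classic) => [k l|y yab l].
  by rewrite (ord1 k); apply: open_nbhs_nbhs; split; [exact: interval_open|exact: xab].
exact: yab.
Qed.

Lemma measurable_open_box a b : measurable (open_box a b).
Proof. by apply: open_measurable_rV; exact: open_open_box. Qed.

Lemma lebesgue_rV_open_box a b :
  mu (open_box a b) = (\prod_(l < d) lebesgue_measure (`]a l, b l[%classic : set R))%E.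
Proof. by rewrite -lebesgue_rV_box// => l; exact: measurable_itv. Qed.

Lemma open_element s i : open (element s i).
Proof. by rewrite elementE; exact: open_open_box. Qed.

Lemma measurable_element s i : measurable (element s i).
Proof. by apply: open_measurable_rV; exact: open_element. Qed.

Lemma lebesgue_rV_open_boxE a b : (forall l, a l <= b l) ->
  mu (open_box a b) = (\prod_(l < d) (b l - a l))%:E.
Proof.
move=> ab; rewrite lebesgue_rV_open_box (@big_morph _ _ EFin 1%E *%E 1 *%R)//.
apply: eq_bigr => l _; rewrite lebesgue_measure_itv/= lte_fin -EFinB.
by have := ab l; rewrite le_eqVlt => /predU1P[->|->//]; rewrite ltxx subrr.
Qed.

Lemma element_lty s i : 0 < s -> (mu (element s i) < +oo)%E.
Proof.
move=> s0; rewrite elementE lebesgue_rV_open_boxE ?ltry// => l.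
by rewrite ler_pM2r// lerDl.
Qed.

Lemma integrable_element s i f : 0 < s -> continuous f ->
  mu.-integrable (element s i) (EFin \o f).
Proof.
move=> s0 cf; apply: measurable_bounded_integrable.
- exact: measurable_element.
- exact: element_lty.
- by apply: measurable_funTS; exact: continuous_measurable_rV.
pose K := [set x : 'rV[R]_d | forall l,
  `[(i ord0 l)%:~R * s, ((i ord0 l)%:~R + 1) * s]%classic (x ord0 l)].
have cK : compact (f @` K).
  apply: continuous_compact; first exact: continuous_subspaceT.
  by apply: (@rV_compact R d (fun l => `[(i ord0 l)%:~R * s, ((i ord0 l)%:~R + 1) *
    s]%classic)) => l; exact: segment_compact.
have [M [Mr fM]] := compact_bounded cK; exists M; split=> // N MN x xi.
apply: fM MN _ _; exists x => // l; have /andP[h1 h2] := xi l.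
by rewrite /= in_itv/= !ltW.
Qed.

(** If f x were nonzero, f^2 would exceed half its value at x on a small box inside the element, and
    that box has positive measure. *)
Lemma integral_sqr_element_eq0 s i f : 0 < s -> continuous f ->
  \int[mu]_(x in element s i) (f x ^+ 2) = 0 -> forall x, element s i x -> f x = 0.
Proof.
move=> s0 cf f0 x xi; apply/eqP/negPn/negP => fx0.
have cf2 : continuous (fun x => f x ^+ 2).
  by move=> y; apply: (@continuousM _ _ f f y); exact: cf.
have if2 := integrable_element i s0 cf2.
have fx2 : 0 < f x ^+ 2 by rewrite lt_def sqrf_eq0 fx0 sqr_ge0.
have : nbhs x ([set y | f x ^+ 2 / 2 < f y ^+ 2] `&` element s i).
  apply: filterI; last by apply: open_nbhs_nbhs; split=> //; exact: open_element.
  by apply: (cf2 x [set z | f x ^+ 2 / 2 < z]); apply: lt_nbhsr; lra.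
move=> /nbhs_rVP[e e0 xe].
pose B := open_box (fun l => x ord0 l - e) (fun l => x ord0 l + e).
have Be : B `<=` [set y | f x ^+ 2 / 2 < f y ^+ 2] `&` element s i.
  move=> y yB; apply: xe => l; have := yB l; rewrite /= in_itv/= => /andP[? ?].
  by rewrite ltr_norml; apply/andP; split; lra.
have : (0 < \int[mu]_(x in element s i) (f x ^+ 2)%:E)%E.
  apply: (@lt_le_trans _ _ (\int[mu]_(y in B) cst (f x ^+ 2 / 2)%:E y)%E).
    rewrite integral_cst; last exact: measurable_open_box.
    have ab l : x ord0 l - e <= x ord0 l + e by lra.
    rewrite [_ B](lebesgue_rV_open_boxE ab) -EFinM lte_fin mulr_gt0 ?divr_gt0//;
      apply: prodr_gt0 => l _; lra.
  apply: (@le_trans _ _ (\int[mu]_(y in B) (f y ^+ 2)%:E)%E).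
    apply: ge0_le_integral.
    - exact: measurable_open_box.
    - by move=> y _; rewrite lee_fin ltW// divr_gt0.
    - exact: measurable_cst.
    - by apply/measurable_EFinP; apply: measurable_funTS; exact:
        continuous_measurable_rV.
    - by move=> y /Be[/= h _]; rewrite lee_fin ltW.
  apply: ge0_subset_integral.
  - exact: measurable_open_box.
  - exact: measurable_element.
  - by apply/measurable_EFinP; apply: measurable_funTS; exact: continuous_measurable_rV.
  - by move=> y _; rewrite lee_fin sqr_ge0.
  - by move=> y /Be[].
(* Finiteness matters: the real integral is also 0 when the extended one is infinite. *)
rewrite -(fineK (integrable_fin_num (measurable_element s i) if2)).
by rewrite -[fine _]/(Rintegral _ _ _) f0 ltxx.
Qed.

End elements.

(** * Unique continuation across a node *)

Section unique_continuation.
Context {R : realType} {d : nat}.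
Implicit Types (s : R) (i : 'rV[int]_d) (f g : 'rV[R]_d -> R).

Lemma is_derive_on_line f (x v : 'rV[R]_d) (t df : R) :
  is_derive (t *: v + x) v f df -> is_derive t 1 (fun t : R => f (t *: v + x)) df.
Proof.
move=> [df1 df2].
have e : (fun r : R => r^-1 *: (((fun t : R => f (t *: v + x)) \o shift t) (r *: (1
  : R)) -
      f (t *: v + x))) = (fun r : R => r^-1 *: ((f \o shift (t *: v + x)) (r *: v)
        - f (t *: v + x))).
  by apply/funext => r /=; rewrite [r *: _]mulr1 scalerDl addrA.
by apply: DeriveDef; rewrite ?/derivable ?/derive e.
Qed.

Lemma is_derive0_eq (g : R -> R) (a b : R) :
  (forall t, Num.min a b <= t <= Num.max a b -> is_derive t 1 g 0) -> g a = g b.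
Proof.
wlog ab : a b / a <= b => [H dg|].
  have [ab|/ltW ba] := leP a b; first exact: H.
  by apply/esym/H => // t; rewrite minC maxC; exact: dg.
rewrite min_l// max_r// => dg.
have [||c _] := @MVT_segment R g (cst 0) a b ab.
- by move=> x; rewrite in_itv/= => /andP[h1 h2]; apply: dg; rewrite !ltW.
- apply: derivable_within_continuous => x; rewrite in_itv/= => xab.
  by have [] := dg x xab.
- by rewrite /= mul0r => /eqP; rewrite subr_eq0 => /eqP.
Qed.

(** The points are joined by exchanging one coordinate at a time; the path stays in the element, a
    product of intervals. *)
Lemma element_cst s i f :
  (forall (k : 'I_d) x, element s i x -> is_derive x (delta_mx ord0 k) f 0) ->
  forall x y, element s i x -> element s i y -> f x = f y.
Proof.
move=> df x y xi yi.
pose z j : 'rV[R]_d := \row_(l < d) if (l < j)%N then y ord0 l else x ord0 l.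
have zi j : element s i (z j).
  by move=> l; rewrite mxE; case: ifP => _; [exact: yi|exact: xi].
suff H j : (j <= d)%N -> f (z j) = f x.
  by rewrite -(H d (leqnn d)); congr f; apply/rowP => l; rewrite mxE ltn_ord.
elim: j => [_|j IH jd].
  by congr f; apply/rowP => l; rewrite mxE.
rewrite -{}IH; last exact: ltnW.
pose k := Ordinal jd; pose D := y ord0 k - x ord0 k.
have -> : z j.+1 = D *: delta_mx ord0 k + z j.
  apply/rowP => l; rewrite !mxE eqxx /=.
  have [->|lk] := eqVneq l k; first by rewrite /= ltnS leqnn ltnn mulr1 subrK.
  rewrite mulr0 add0r ltnS leq_eqVlt (_ : (l == j :> nat) = false)//.
  by apply/negbTE; apply: contra lk => /eqP lj; apply/eqP/val_inj.
rewrite -{2}(add0r (z j)) -(scale0r (delta_mx ord0 k)).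
apply: (@is_derive0_eq (fun t => f (t *: delta_mx ord0 k + z j)) D 0) => t tD.
apply: is_derive_on_line; apply: df => l; have zl := zi j l; rewrite !mxE in zl;
  rewrite !mxE eqxx/=.
have [->|lk] := eqVneq l k; last by rewrite mulr0 add0r.
rewrite mulr1 ltnn.
have /andP[x1 x2] := xi k; have /andP[y1 y2] := yi k.
move: tD; rewrite /D; have [h|h] := leP (y ord0 k - x ord0 k) 0.
  by move=> /andP[? ?]; apply/andP; split; lra.
by move=> /andP[? ?]; apply/andP; split; lra.
Qed.

Lemma closure_eq0 f (A : set 'rV[R]_d) z : continuous f ->
  (forall x, A x -> f x = 0) -> closure A z -> f z = 0.
Proof.
move=> cf fA; suff : closure A `<=` f @^-1` [set 0] by apply.
have -> : f @^-1` [set 0] = closure (f @^-1` [set 0]).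
  apply/closure_id; apply: preimage_closed; last exact: closed_eq.
  by move=> x _; exact: cf.
exact: closureS.
Qed.

Lemma derive_tensor1 (k : 'I_d) (a : 'I_d -> nat) (h : 'I_d -> R -> R) :
  derive_tensor (fun l => (l == k)%N : nat) (derive_tensor a h) =
  derive_tensor (fun l => (l == k) + a l)%N h.
Proof. by apply/funext => l; rewrite /derive_tensor /derive1n iterD. Qed.

Section kernel.
Context {I : Type} (r : seq I) (c : I -> R) (h : I -> 'I_d -> R -> R).
Hypothesis sh : forall t l, smooth (h t l).
Local Notation F a := (tensor_sum r c (fun t => derive_tensor a (h t))).

Let cF a : continuous (F a).
Proof. by apply: continuous_tensor_sum => t; exact: smooth_derive_tensor. Qed.

Let dF a k x : is_derive x (delta_mx ord0 k) (F a) (F (fun l => (l == k) + a l)%N x).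
Proof.
have := is_derive_tensor_sum r c k x (fun t => smooth_derive_tensor a (sh t)).
by under [X in is_derive _ _ _ (tensor_sum _ _ X _)]eq_fun do rewrite derive_tensor1.
Qed.

(* The derivatives of order m vanish on the first element.  If those of order
   q+1 do, then those of order q are constant there, and they vanish at a point
   shared with the closure of the second element, where the function is 0. *)
Lemma tensor_sum_eq0 s i j z m :
  closure (element s i) z -> closure (element s j) z ->
  (forall a, (\sum_l a l = m)%N -> forall x, element s i x -> F a x = 0) ->
  (forall x, element s j x -> tensor_sum r c h x = 0) ->
  forall x, element s i x -> tensor_sum r c h x = 0.
Proof.
move=> zi zj Fm Fj.
have F0 : tensor_sum r c h = F (fun=> 0%N) by [].
have Fja q a : (\sum_l a l = q)%N -> forall x, element s j x -> F a x = 0.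
  elim: q a => [|q IH] a aq x xj.
    rewrite (_ : a = fun=> 0%N); first by rewrite -F0 Fj.
    apply/funext => l; apply/eqP; move/eqP : aq; rewrite sum_nat_eq0 => /forallP/(_ l).
    by rewrite implyTb.
  have [k ak] : exists k, (0 < a k)%N.
    apply/existsP; rewrite -[X in is_true X]negbK negb_exists; apply/negP => /forallP H.
    by move: aq; rewrite big1// => l _; apply/eqP; rewrite -leqn0 leqNgt H.
  pose b l := (a l - (l == k))%N.
  have ab : a = fun l => ((l == k) + b l)%N.
    by apply/funext => l; rewrite /b subnKC//; case: eqVneq => // ->.
  have bq : (\sum_l b l = q)%N.
    move: aq; rewrite {1}ab big_split/= (bigD1 k)//= eqxx big1 => [|l lk]; first by
      rewrite addn0 add1n => -[].
    by rewrite (negbTE lk).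
  rewrite ab; have [_ <-] := dF b k x.
  rewrite (@near_eq_derive _ _ _ _ (cst 0)) ?derive_cst//.
  have : nbhs x (element s j) by apply: open_nbhs_nbhs; split=> //; exact: open_element.
  by apply: filterS => y yj; rewrite (IH b).
(* Downward induction on the order of [a], with [q] its distance from m. *)
suff H q a : (\sum_l a l + q = m)%N -> forall x, element s i x -> F a x = 0.
  by move=> x xi; rewrite F0 (H m)// sum_nat_const muln0.
elim: q a => [|q IH] a aq x xi; first by apply: Fm => //; rewrite -aq addn0.
have Fcst y : element s i y -> F a y - F a x = 0.
  move=> yi; apply/eqP; rewrite subr_eq0; apply/eqP.
  apply: (element_cst _ yi xi) => k w wi.
  rewrite -(IH (fun l => (l == k) + a l)%N _ w wi); first exact: dF.
  by rewrite big_split/= (bigD1 k)//= eqxx big1 => [|l /negbTE->//]; rewrite addn0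
    add1n addSn -aq addnS.
have Faz : F a z = 0 by exact: (closure_eq0 (@cF a) (Fja _ a erefl) zj).
have : F a z - F a x = 0.
  apply: (@closure_eq0 (fun y => F a y - F a x) _ z _ Fcst zi) => y.
  by apply: (@continuousB _ _ _ (F a) (cst (F a x)) y); [exact: cF|exact:
    cst_continuous].
by rewrite Faz sub0r => /eqP; rewrite oppr_eq0 => /eqP.
Qed.

End kernel.

End unique_continuation.

(** * The estimate for two neighboring elements *)

Section reference_bound.
Context {R : realType} {d : nat}.
Local Notation mu := (lebesgue_rV d).

Lemma psd_form_add (U : lmodType R) (a b : U -> U -> R) :
  psd_form a -> psd_form b -> psd_form (fun u v => a u v + b u v).
Proof.
move=> [sa la pa] [sb lb pb]; split=> [u v|c u v w|v].
- by rewrite sa sb.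
- by rewrite la lb; ring.
- by rewrite addr_ge0.
Qed.

Lemma psd_form_sum (U : lmodType R) (J : Type) (r : seq J) (P : pred J) (a : J -> U
  -> U -> R) :
  (forall j, psd_form (a j)) -> psd_form (fun u v => \sum_(j <- r | P j) a j u v).
Proof.
move=> pa; split=> [u v|c u v w|v].
- by apply: eq_bigr => j _; rewrite (psd_formC (pa j)).
- rewrite mulr_sumr -big_split; apply: eq_bigr => j _ /=.
  by have [_ -> _] := pa j.
- by apply: sumr_ge0 => j _; exact: psd_form_ge0.
Qed.

Lemma psd_form_integral (U : lmodType R) (G : U -> 'rV[R]_d -> R) (s : R) (i :
  'rV[int]_d) :
  0 < s -> (forall v, continuous (G v)) ->
  (forall c u v x, G (c *: u + v) x = c * G u x + G v x) ->
  psd_form (fun u v => \int[mu]_(x in element s i) (G u x * G v x)).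
Proof.
move=> s0 cG lG.
have iG u v : mu.-integrable (element s i) (EFin \o (fun x => G u x * G v x)).
  by apply: integrable_element => // x; apply: (@continuousM _ _ (G u) (G v));
    exact: cG.
split=> [u v|c u v w|v].
- by apply: eq_Rintegral => x _; rewrite mulrC.
- rewrite -RintegralZl//; last exact: measurable_element.
  rewrite -RintegralD//; first last.
  + have := iG (c *: u) w.
    have e x : G (c *: u) x = c * G u x.
      have := lG c u 0 x; have := lG 1 0 0 x.
      by rewrite scale1r !addr0 mul1r => h ->; lra.
    by rewrite (_ : (fun x => _) = (fun x => c * (G u x * G w x)))//; apply/funext
      => x; rewrite e mulrA.
  + exact: measurable_element.
  by apply: eq_Rintegral => x _; rewrite lG; ring.
- by apply: Rintegral_ge0 => x _; rewrite -expr2 sqr_ge0.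
Qed.

(** Both sides are semidefinite forms in the coefficient vector, and [tensor_sum_eq0] provides the
    kernel inclusion. The bound thus holds for all c with a constant fixed by h, m, s, i and j. *)
Lemma reference_bound n (h : 'I_n -> 'I_d -> R -> R) (m : nat) (s : R)
    (i j : 'rV[int]_d) (z : 'rV[R]_d) : 0 < s -> (forall t l, smooth (h t l)) ->
  closure (element s i) z -> closure (element s j) z ->
  exists2 C : R, 0 <= C & forall c : 'I_n -> R,
    let F a := tensor_sum (index_enum 'I_n) c (fun t => derive_tensor a (h t)) in
    \int[mu]_(x in element s i) (F (fun=> 0%N) x ^+ 2) <=
    C * (\int[mu]_(x in element s j) (F (fun=> 0%N) x ^+ 2) +
         \sum_(a : {ffun 'I_d -> 'I_m.+1} | (\sum_(l < d) a l == m)%N)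
           \int[mu]_(x in element s i) (F (fun l => a l) x ^+ 2)).
Proof.
move=> s0 sh zi zj.
pose G (a : 'I_d -> nat) (v : 'rV[R]_n) :=
  tensor_sum (index_enum 'I_n) (v ord0) (fun t => derive_tensor a (h t)).
have cG a v : continuous (G a v).
  by apply: continuous_tensor_sum => t; exact: smooth_derive_tensor.
have lG a c u v x : G a (c *: u + v) x = c * G a u x + G a v x.
  rewrite /G /tensor_sum mulr_sumr -big_split; apply: eq_bigr => t _ /=.
  by rewrite !mxE; ring.
pose B (u v : 'rV[R]_n) := \int[mu]_(x in element s i) (G (fun=> 0%N) u x * G
  (fun=> 0%N) v x).
pose A (u v : 'rV[R]_n) := \int[mu]_(x in element s j) (G (fun=> 0%N) u x * G
  (fun=> 0%N) v x) +
  \sum_(a : {ffun 'I_d -> 'I_m.+1} | (\sum_(l < d) a l == m)%N)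
    \int[mu]_(x in element s i) (G (fun l => a l) u x * G (fun l => a l) v x).
have pB : psd_form B by exact: psd_form_integral.
have pA : psd_form A.
  apply: psd_form_add; first exact: psd_form_integral.
  by apply: psd_form_sum => a; exact: psd_form_integral.
have [|C C0 AB] := @psd_form_dominated _ _ A B pA pB n (fun k => delta_mx ord0 k).
  move=> c; set v := \sum_k _ => /=.
  have int_ge0 k a : 0 <= \int[mu]_(x in element s k) (G a v x * G a v x).
    by apply: Rintegral_ge0 => x _; rewrite -expr2 sqr_ge0.
  move/eqP; rewrite paddr_eq0//; last exact: sumr_ge0.
  move=> /andP[/eqP Aj]; rewrite psumr_eq0// => /allP Ai.
  have F0 : forall x, element s i x -> G (fun=> 0%N) v x = 0.
    apply: (@tensor_sum_eq0 _ _ _ (index_enum 'I_n) (v ord0) h sh s i j z m zi zj).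
      (* A multi-index of order m has entries at most m, so it occurs in the finite index type of
         the sum. *)
      move=> a am; have lam l : (a l < m.+1)%N.
        by rewrite ltnS -am (bigD1 l)//= leq_addr.
      pose b := [ffun l => Ordinal (lam l)].
      have ab : (fun l => b l : nat) = a by apply/funext => l; rewrite ffunE.
      have bm : (\sum_l b l = m)%N by apply: etrans am; apply: eq_bigr => l _;
        rewrite ffunE.
      have := Ai b (mem_index_enum _); rewrite bm eqxx ab => /eqP Gb.
      by apply: integral_sqr_element_eq0 => //; exact: (cG a v).
    by apply: integral_sqr_element_eq0 => //; exact: (cG (fun=> 0%N) v).
  rewrite /B /Rintegral integral0_eq// => x xi.
  by rewrite F0// mulr0.
exists C => [//|c /=].
have := AB c => /=; have -> : \sum_k c k *: delta_mx ord0 k = \row_k c k.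
  by rewrite [RHS]row_sum_delta; apply: eq_bigr => k _; rewrite mxE.
have e : (\row_k c k) ord0 = c by apply/funext => k; rewrite mxE.
by rewrite /A /B /G e.
Qed.

End reference_bound.

(** * Change of variables between the unit grid and the grid of size s *)

Section scaling.
Context {R : realType} {d : nat}.
Local Notation mu := (lebesgue_rV d).
Implicit Types (s : R) (i e : 'rV[int]_d) (x y : 'rV[R]_d).

Lemma closure_elementP s i x : 0 < s -> closure (element s i) x <->
  forall l, (i ord0 l)%:~R * s <= x ord0 l <= ((i ord0 l)%:~R + 1) * s.
Proof.
move=> s0; split=> [xi l|xi A /nbhs_rVP[e e0 xA]].
  pose D := [set x : 'rV[R]_d | `[(i ord0 l)%:~R * s, ((i ord0 l)%:~R + 1) *
    s]%classic (x ord0 l)].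
  suff : D x by rewrite /D/= in_itv.
  have cD : closed D.
    apply: (@preimage_closed _ _ (fun x : 'rV[R]_d => x ord0 l)); last exact:
      interval_closed.
    by move=> y _; exact: coord_continuous.
  move/closure_id : cD => ->; apply: closureS xi => y /(_ l)/andP[h1 h2].
  by rewrite /D/= in_itv/= !ltW.
(* Moving x towards the center by the fraction t leads into the open element; t <= e/s keeps the
   displacement below e. *)
pose t := Num.min 1 (e / s).
have t0 : 0 < t by rewrite lt_min ltr01 divr_gt0.
have t1 : t <= 1 by rewrite ge_min lexx.
have te : t * s <= e by rewrite -ler_pdivlMr// ge_min lexx orbT.
exists (\row_l (x ord0 l + t * ((i ord0 l)%:~R * s + s / 2 - x ord0 l))); split.
  move=> l; rewrite mxE; have /andP[] := xi l; rewrite mulrDl mul1r.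
  move: (_%:~R * s) (x ord0 l) => a b ab ba; apply/andP; split; nra.
apply: xA => l; rewrite mxE; have /andP[] := xi l; rewrite mulrDl mul1r.
move: (_%:~R * s) (x ord0 l) => a b ab ba.
by rewrite ltr_norml; apply/andP; split; nra.
Qed.

Definition int_row i : 'rV[R]_d := \row_l (i ord0 l)%:~R.

Definition grid_map s i y : 'rV[R]_d := s *: (y + int_row i).

Lemma grid_mapE s i y l : grid_map s i y ord0 l = s * (y ord0 l + (i ord0 l)%:~R).
Proof. by rewrite !mxE. Qed.

Lemma element_grid_map s i e y : 0 < s ->
  element s (i + e) (grid_map s i y) <-> element 1 e y.
Proof.
move=> s0; have aux l : ((i + e) ord0 l)%:~R * s < grid_map s i y ord0 l < (((i +
  e) ord0 l)%:~R + 1) * s <->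
    (e ord0 l)%:~R * 1 < y ord0 l < ((e ord0 l)%:~R + 1) * 1.
  rewrite grid_mapE [(i + e) _ _]mxE intrD !mulr1 !(mulrC _ s) !ltr_pM2l//.
  by rewrite -addrA (addrC (y ord0 l)) !ltrD2l.
by split=> h l; apply/aux; exact: h.
Qed.

Lemma continuous_grid_map s i : continuous (grid_map s i).
Proof.
move=> y; apply: (@continuous_comp _ _ _ (fun y => y + int_row i)); last exact:
  scaler_continuous.
by apply: (@continuousD _ _ _ id (cst (int_row i)) y); [exact: cvg_id|exact:
  cst_continuous].
Qed.

Lemma integral_grid_map s i e (f : 'rV[R]_d -> R) : 0 < s -> continuous f ->
  \int[mu]_(x in element s (i + e)) (f x ^+ 2) =
  s ^+ d * \int[mu]_(y in element 1 e) (f (grid_map s i y) ^+ 2).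
Proof.
move=> s0 cf; have cf2 : continuous (fun x => f x ^+ 2).
  by move=> y; apply: (@continuousM _ _ f f y); exact: cf.
have cfg : continuous (fun y => f (grid_map s i y) ^+ 2).
  by move=> y; exact: (continuous_comp (@continuous_grid_map s i y) (cf2 _)).
have mf : measurable_fun (element s (i + e)) (fun x => (f x ^+ 2)%:E).
  by apply/measurable_EFinP; apply: measurable_funTS; exact: continuous_measurable_rV.
rewrite /Rintegral integral_mkcond (ge0_integral_rV_affine (int_row i) s0); first last.
- by move=> x; rewrite patchE; case: ifP => // _; rewrite lee_fin sqr_ge0.
- exact: (measurable_restrictT _ (measurable_element s (i + e))).1 mf.
rewrite [X in (_ * X)%E](_ : _ =
    (\int[mu]_(y in element 1 e) (f (grid_map s i y) ^+ 2)%:E)%E).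
  rewrite fineM//; apply: integrable_fin_num; first exact: measurable_element.
  exact: (@integrable_element _ _ 1 e (fun y => f (grid_map s i y) ^+ 2)).
rewrite [RHS]integral_mkcond; apply: eq_integral => y _.
rewrite !patchE -/(grid_map s i y).
have [ye|ye] := boolP (y \in element 1 e).
  by rewrite mem_set//; apply/element_grid_map => //; exact: set_mem.
rewrite memNset// => /(element_grid_map i e y s0) yE.
by move: ye; rewrite mem_set.
Qed.

End scaling.

(** * Trial functions in reference coordinates and the uniform bound for neighbors *)

Section local_bound.
Context {R : realType} {d : nat}.
Local Notation mu := (lebesgue_rV d).
Local Notation pum_index := (R * 'rV[int]_d * {ffun 'I_d -> nat})%type.
Implicit Types (s : R) (i e : 'rV[int]_d) (x y : 'rV[R]_d) (w : seq pum_index).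

(** The unrestricted combination behind a member of [pum_space]: a representative smooth on the
    whole space. *)
Definition pum_fun s w x : R :=
  \sum_(t <- w) t.1.1 * (pou s t.1.2 x * monomial t.2 x).

(** The [+ 0] gives the argument of [hat] the shape expected by [smooth_affine]. *)
Definition pum_factor s (t : pum_index) (l : 'I_d) (r : R) : R :=
  hat (s^-1 * (r + 0) + - (t.1.2 ord0 l)%:~R) * r ^+ t.2 l.

Lemma smooth_affine (f : R -> R) (a b : R) : smooth f -> smooth (fun r => f (a * (r
  + b))).
Proof.
move=> sf; apply: (@smooth_comp _ f (fun r => a * (r + b))) => //.
apply: smoothM; first exact: smooth_cst.
by apply: smoothD; [exact: smooth_id|exact: smooth_cst].
Qed.

Lemma smooth_pum_factor s t l : smooth (pum_factor s t l).
Proof.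
apply: smoothM.
  apply: (@smooth_affine (fun r => hat (r + - (t.1.2 ord0 l)%:~R))).
  exact/smooth_shift/smooth_hat.
rewrite (_ : (fun r : R => r ^+ t.2 l) = horner 'X^(t.2 l)); first exact: smooth_poly.
by apply/funext => r; rewrite hornerXn.
Qed.

Lemma pum_funE s w : 0 < s -> pum_fun s w = tensor_sum w (fun t => t.1.1)
  (pum_factor s).
Proof.
move=> s0; apply/funext => x; apply: eq_bigr => t _; congr (_ * _).
rewrite pouE// /monomial -big_split; apply: eq_bigr => l _.
by rewrite /pum_factor addr0 [_^-1 * _]mulrC.
Qed.

Lemma continuous_pum_fun s w : 0 < s -> continuous (pum_fun s w).
Proof. by move=> s0; rewrite pum_funE//; apply: continuous_tensor_sum => t l;
  exact: smooth_pum_factor. Qed.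

Lemma partial_pum_fun s w a : 0 < s ->
  partial a (pum_fun s w) = tensor_sum w (fun t => t.1.1) (fun t => derive_tensor a
    (pum_factor s t)).
Proof. by move=> s0; rewrite pum_funE// partial_tensor_sum// => t l; exact:
  smooth_pum_factor. Qed.

Lemma continuous_partial_pum_fun s w a : 0 < s -> continuous (partial a (pum_fun s w)).
Proof.
move=> s0; rewrite partial_pum_fun//; apply: continuous_tensor_sum => t.
by apply: smooth_derive_tensor => l; exact: smooth_pum_factor.
Qed.

Lemma derive1n_affine (f : R -> R) (a b : R) n : smooth f ->
  derive1n n (fun r => f (a * (r + b))) = (fun r => a ^+ n * derive1n n f (a * (r +
    b))).
Proof.
move=> sf; elim: n => [|n IH]; first by apply/funext => r; rewrite expr0 mul1r.
rewrite derive1nS IH; apply/funext => r; rewrite derive1E.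
have d1 : is_derive r (1 : R) (fun r : R => a * (r + b)) a.
  have := is_deriveZ a (is_derive_shift r 1 b).
  by move/is_derive_eq; apply; rewrite [_ *: _]mulr1.
have d2 := smooth_is_derive (a * (r + b)) (smooth_derive1n n sf).
have := is_deriveZ (a ^+ n) (@is_derive1_comp _ (derive1n n f) (fun r => a * (r +
  b)) r _ _ d2 d1).
move=> [_ ->]; rewrite derive1nS /GRing.scale/= exprSr; ring.
Qed.

Definition pum_grid s i (t : pum_index) (l : 'I_d) (r : R) : R :=
  pum_factor s t l (s * (r + (i ord0 l)%:~R)).

Lemma smooth_pum_grid s i t l : smooth (pum_grid s i t l).
Proof. exact: smooth_affine (smooth_pum_factor s t l). Qed.

Lemma pum_fun_grid s w i : 0 < s ->
  pum_fun s w \o grid_map s i = tensor_sum w (fun t => t.1.1) (pum_grid s i).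
Proof.
move=> s0; rewrite pum_funE//; apply/funext => y; apply: eq_bigr => t _.
by congr (_ * _); apply: eq_bigr => l _; rewrite grid_mapE.
Qed.

(** For order P+1 the square of this factor is the weight of the stabilization form. *)
Lemma partial_pum_fun_grid s w i a y : 0 < s ->
  partial a (pum_fun s w \o grid_map s i) y =
  s ^+ (\sum_l a l) * partial a (pum_fun s w) (grid_map s i y).
Proof.
move=> s0; rewrite pum_fun_grid// partial_tensor_sum; last by move=> t l; exact:
  smooth_pum_grid.
rewrite partial_pum_fun// /tensor_sum mulr_sumr; apply: eq_bigr => t _.
rewrite mulrCA; congr (_ * _).
rewrite /tensor (@big_morph _ _ (fun n => s ^+ n) 1 *%R 0%N addn (exprD s) (expr0 s)).
rewrite -big_split; apply: eq_bigr => l _.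
rewrite /derive_tensor /pum_grid derive1n_affine; last exact: smooth_pum_factor.
by rewrite grid_mapE.
Qed.

Section reference_functions.
Variable P : nat.

(** A first entry c stands for the node c - 1. Exponents are bounded by P in each coordinate
    separately, because the polynomial factors are multiplied out coordinate by coordinate. *)
Definition ref_index := ({ffun 'I_d -> 'I_4} * {ffun 'I_d -> 'I_P.+1})%type.

Definition ref_factor (k : ref_index) (l : 'I_d) (r : R) : R :=
  hat (r + (1 - (k.1 l)%:R)) * r ^+ k.2 l.

Lemma smooth_ref_factor k l : smooth (ref_factor k l).
Proof.
apply: smoothM; first exact/smooth_shift/smooth_hat.
rewrite (_ : (fun r : R => r ^+ k.2 l) = horner 'X^(k.2 l)); first exact: smooth_poly.
by apply/funext => r; rewrite hornerXn.
Qed.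

(* On the cube (-1, 2)^d only the nodes -1, 0, 1, 2 in each coordinate matter,
   and the affine change of variable preserves the degrees. *)
Lemma tensor_pum_grid s i (t : pum_index) : 0 < s -> (\sum_l t.2 l <= P)%N ->
  exists v : ref_index -> R, forall y, (forall l, -1 < y ord0 l < 2) ->
    tensor (pum_grid s i t) y = \sum_k v k * tensor (ref_factor k) y.
Proof.
move=> s0 tP.
pose q l : {poly R} := (s *: ('X + (i ord0 l)%:~R%:P)) ^+ t.2 l.
have tE l (r : R) : pum_grid s i t l r =
    hat (r + (i ord0 l - t.1.2 ord0 l)%:~R) * (q l).[r].
  rewrite /pum_grid /pum_factor addr0 mulKf ?gt_eqF// intrB addrA; congr (_ * _).
  by rewrite horner_exp hornerZ hornerD hornerX hornerC.
have sq l : (size (q l) <= P.+1)%N.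
  apply: (leq_trans (size_poly_exp_leq _ _)); rewrite ltnS.
  have s2 : ((size (s *: ('X + (i ord0 l)%:~R%:P))).-1 <= 1)%N.
    by rewrite -subn1 leq_subLR (leq_trans (size_scale_leq _ _))// size_XaddC.
  apply: (leq_trans (leq_mul s2 (leqnn _))); rewrite mul1n.
  by apply: leq_trans tP; rewrite (bigD1 l)//= leq_addr.
(* If the center is off the nodes -1, ..., 2 in coordinate l, the argument of [hat] there has
   absolute value at least 1 on (-1, 2). *)
have [inr|/existsNP[l outr]] := pselect (forall l, -1 <= t.1.2 ord0 l - i ord0 l <=
  2); last first.
  exists (fun=> 0) => y yl; rewrite [RHS]big1 => [|k _]; last by rewrite mul0r.
  rewrite /tensor (bigD1 l)//= tE hat_eq0 ?mul0r//.
  have /andP[y1 y2] := yl l.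
  have [h|h] : (2 <= i ord0 l - t.1.2 ord0 l \/ i ord0 l - t.1.2 ord0 l <= - 3) by lia.
    have : (2%:~R : R) <= (i ord0 l - t.1.2 ord0 l)%:~R by rewrite ler_int.
    by move=> h'; rewrite ler_normr; apply/orP; left; lra.
  have : ((i ord0 l - t.1.2 ord0 l)%:~R : R) <= (- 3)%:~R by rewrite ler_int.
  by move=> h'; rewrite ler_normr; apply/orP; right; lra.
pose c : {ffun 'I_d -> 'I_4} := [ffun l => inord (absz (t.1.2 ord0 l - i ord0 l +
  1)%R)].
have cE l : 1 - (c l)%:R = (i ord0 l - t.1.2 ord0 l)%:~R :> R.
  have tl := inr l.
  rewrite ffunE inordK; last by lia.
  have -> : ((absz (t.1.2 ord0 l - i ord0 l + 1)%R)%:R : R) = (t.1.2 ord0 l - i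
    ord0 l + 1)%:~R.
    by rewrite natr_absz ger0_norm//; lia.
  by rewrite -[X in X - _]/(1%:~R) -intrB; congr intmul; lia.
(* Only the translate [c] occurs; its coefficients are products of coefficients of the polynomials
   [q l]. *)
exists (fun k : ref_index => if k.1 == c then \prod_l (q l)`_(k.2 l) else 0) => y yl.
rewrite -(pair_bigA _ (fun (g : {ffun 'I_d -> 'I_4}) (b : {ffun 'I_d -> 'I_P.+1})
  => (if g == c then \prod_l (q l)`_(b l) else 0) * tensor (ref_factor (g, b)) y))/=.
rewrite (bigD1 c)//= [X in _ + X]big1 ?addr0; last first.
  by move=> g gc; apply: big1 => b _; rewrite (negbTE gc) mul0r.
(* [ref_factor] at l reads only the exponent at l, so a constant multi-index represents it until the
   product of sums is distributed. *)
rewrite /tensor (eq_bigr (fun l => \sum_(b < P.+1) (q l)`_b * ref_factor (c,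
  [ffun=> b]) l (y ord0 l))).
  rewrite bigA_distr_bigA; apply: eq_bigr => b _; rewrite eqxx -big_split.
  by apply: eq_bigr => l _; rewrite /ref_factor/= (ffunE (fun=> b l)).
move=> l _; rewrite tE (horner_coef_wide _ (sq l)) mulr_sumr; apply: eq_bigr => b _.
by rewrite /ref_factor/= (ffunE (fun=> b)) cE mulrCA.
Qed.

End reference_functions.

Lemma pum_fun_grid_span P s i w : 0 < s ->
  (forall t, t \in w -> (\sum_l t.2 l <= P)%N) ->
  exists v : ref_index P -> R, forall y, (forall l, -1 < y ord0 l < 2) ->
    pum_fun s w (grid_map s i y) = \sum_k v k * tensor (ref_factor k) y.
Proof.
move=> s0; elim: w => [_|t w IH wP].
  by exists (fun=> 0) => y _; rewrite /pum_fun big_nil big1// => k _; rewrite mul0r.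
have [|v vE] := IH; first by move=> u uw; apply: wP; rewrite inE uw orbT.
have [|u uE] := @tensor_pum_grid P s i t s0; first by apply: wP; rewrite mem_head.
exists (fun k => t.1.1 * u k + v k) => y yl.
have := congr1 (fun f => f y) (pum_fun_grid [:: t] i s0).
rewrite /tensor_sum /= big_seq1 uE// {1}/pum_fun big_seq1 => tE.
rewrite /pum_fun big_cons tE -/(pum_fun s w (grid_map s i y)) vE// mulr_sumr -big_split.
by apply: eq_bigr => k _ /=; rewrite mulrDl mulrA.
Qed.

Definition seminorm_sqr (P : nat) s i (f : 'rV[R]_d -> R) : R :=
  \sum_(a : {ffun 'I_d -> 'I_P.+2} | (\sum_(l < d) a l == P.+1)%N)
    \int[mu]_(x in element s i) (partial (fun l => a l) f x ^+ 2).

Lemma shared_corner e : (forall l, -1 <= e ord0 l <= 1) ->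
  exists z : 'rV[R]_d, closure (element 1 0) z /\ closure (element 1 e) z.
Proof.
(* Per coordinate: 1 is shared when the offset is 1, 0 when it is -1, and 0 also serves when it is
   0. *)
move=> e1; exists (\row_l (if e ord0 l == 1 then 1 else 0)).
split; apply/closure_elementP => // l; rewrite !mxE !mulr1.
  by case: ifP => _; rewrite ?mulr0z ?add0r lexx ler01.
have [->|ne] := eqVneq (e ord0 l) 1; first by rewrite mulr1z lexx lerDl ler01.
have : e ord0 l = 0 \/ e ord0 l = -1 by move: (e1 l) ne; lia.
by move=> [->|->]; rewrite ?mulrN1z ?mulr0z ?add0r ?addNr ?lexx ?ler01 ?lerN10.
Qed.

(** [reference_bound] on the unit elements 0 and e, both inside (-1, 2)^d, fixes C before s, w and i
    are chosen. Pulled back by [grid_map], all three terms acquire the factor s^d, which cancels. *)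
Lemma local_bound_offset P e : (forall l, -1 <= e ord0 l <= 1) ->
  exists2 C : R, 0 <= C & forall s w i, 0 < s ->
    (forall t, t \in w -> (\sum_l t.2 l <= P)%N) ->
    \int[mu]_(x in element s i) (pum_fun s w x ^+ 2) <=
    C * (\int[mu]_(x in element s (i + e)) (pum_fun s w x ^+ 2) +
         s ^+ (2 * P.+1) * seminorm_sqr P s i (pum_fun s w)).
Proof.
move=> e1; have [z [z0 ze]] := shared_corner e1.
pose h (k : 'I_#|{: ref_index P}|) := @ref_factor P (enum_val k).
have sh k l : smooth (h k l) by exact: smooth_ref_factor.
have [C C0 hC] := reference_bound P.+1 (@ltr01 R) sh z0 ze.
exists C => // s w i s0 wP.
have [v vE] := pum_fun_grid_span i s0 wP.
pose F (a : 'I_d -> nat) := tensor_sum (index_enum _) (v \o enum_val) (fun t =>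
  derive_tensor a (h t)).
have FE y : (forall l, -1 < y ord0 l < 2) -> (pum_fun s w \o grid_map s i) y = F
  (fun=> 0%N) y.
  by move=> yl; rewrite /= vE// (reindex _ (onW_bij _ (@enum_val_bij (ref_index P)))).
have F0E y : element 1 0 y -> (pum_fun s w \o grid_map s i) y = F (fun=> 0%N) y.
  move=> ye; apply: FE => l; have := ye l.
  by rewrite mxE mulr0z mul0r add0r mulr1 => /andP[? ?]; apply/andP; split; lra.
have FeE y : element 1 e y -> (pum_fun s w \o grid_map s i) y = F (fun=> 0%N) y.
  move=> ye; apply: FE => l; have := ye l; rewrite !mulr1.
  have /andP[h1 h2] := e1 l.
  have h3 : ((- 1)%:~R : R) <= (e ord0 l)%:~R by rewrite ler_int.
  have h4 : ((e ord0 l)%:~R : R) <= 1%:~R by rewrite ler_int.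
  by move=> /andP[? ?]; apply/andP; split; lra.
have cg := @continuous_pum_fun s w s0.
have e0 : i = i + 0 by rewrite addr0.
have sd0 : 0 < s ^+ d by rewrite exprn_gt0.
have I0 : \int[mu]_(x in element s i) (pum_fun s w x ^+ 2) =
    s ^+ d * \int[mu]_(y in element 1 0) (F (fun=> 0%N) y ^+ 2).
  rewrite {1}e0 integral_grid_map//; congr (_ * _); apply: eq_Rintegral => y.
  by rewrite inE => /F0E <-.
have Ie : \int[mu]_(x in element s (i + e)) (pum_fun s w x ^+ 2) =
    s ^+ d * \int[mu]_(y in element 1 e) (F (fun=> 0%N) y ^+ 2).
  rewrite integral_grid_map//; congr (_ * _); apply: eq_Rintegral => y.
  by rewrite inE => /FeE <-.
have Ia : s ^+ (2 * P.+1) * seminorm_sqr P s i (pum_fun s w) = s ^+ d *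
   \sum_(a : {ffun 'I_d -> 'I_P.+2} | (\sum_(l < d) a l == P.+1)%N)
     \int[mu]_(x in element 1 0) (F (fun l => a l) x ^+ 2).
  rewrite /seminorm_sqr !mulr_sumr; apply: eq_bigr => a /eqP aP.
  rewrite {1}e0 integral_grid_map//; last exact: continuous_partial_pum_fun.
  rewrite mulrCA; congr (_ * _); rewrite -RintegralZl; first last.
  - apply: (@integrable_element _ _ 1 0 (fun y => partial (fun l => a l) (pum_fun s
      w) (grid_map s i y) ^+ 2)) => //.
    have c2 : continuous (fun x => partial (fun l => a l) (pum_fun s w) x ^+ 2).
      move=> y; have cp := @continuous_partial_pum_fun s w (fun l => a l) s0.
      exact: (@continuousM _ _ _ _ _ (cp y) (cp y)).
    by move=> y; exact: (continuous_comp (@continuous_grid_map _ _ s i y) (c2 _)).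
  - exact: measurable_element.
  apply: eq_Rintegral => y; rewrite inE => y0.
  rewrite mulnC exprM -exprMn -{1}aP -partial_pum_fun_grid//.
  (* The reference combination agrees with the trial function only near the origin, which suffices
     for derivatives on the open element. *)
  rewrite (@partial_local _ _ (fun l => a l) _ _ (F (fun=> 0%N)) (@open_element _ _
    1 0) F0E)//.
  by rewrite /F partial_tensor_sum.
by rewrite I0 Ie Ia -mulrDr mulrCA ler_pM2l//; exact: (hC (v \o enum_val)).
Qed.

(** There are 3^d offsets; the sum of their constants serves for all. *)
Lemma local_bound P : exists2 C : R, 0 <= C & forall s w i (k : 'rV[int]_d), 0 < s ->
    (forall t, t \in w -> (\sum_l t.2 l <= P)%N) ->
    (forall l, -1 <= k ord0 l - i ord0 l <= 1) ->
    \int[mu]_(x in element s i) (pum_fun s w x ^+ 2) <=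
    C * (\int[mu]_(x in element s k) (pum_fun s w x ^+ 2) +
         s ^+ (2 * P.+1) * seminorm_sqr P s i (pum_fun s w)).
Proof.
pose off (f : {ffun 'I_d -> 'I_3}) : 'rV[int]_d := \row_l ((f l)%:Z - 1).
have [f|C C0 hC] := @fin_all_exists2 _ _ (fun _ C => 0 <= C) (fun f C => forall s w
  i, 0 < s ->
    (forall t, t \in w -> (\sum_l t.2 l <= P)%N) ->
    \int[mu]_(x in element s i) (pum_fun s w x ^+ 2) <=
    C * (\int[mu]_(x in element s (i + off f)) (pum_fun s w x ^+ 2) +
         s ^+ (2 * P.+1) * seminorm_sqr P s i (pum_fun s w))).
  apply: local_bound_offset => l; rewrite mxE.
  by have := ltn_ord (f l); move: (nat_of_ord (f l)) => q; lia.
exists (\sum_f C f); first exact: sumr_ge0.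
move=> s w i k s0 wP ik.
pose f : {ffun 'I_d -> 'I_3} := [ffun l => inord (absz (k ord0 l - i ord0 l + 1)%R)].
have -> : k = i + off f.
  apply/rowP => l; rewrite !mxE ffunE.
  have : forall a b : int, -1 <= a - b <= 1 ->
      a = b + ((inord (absz (a - b + 1)%R) : 'I_3)%:Z - 1).
    by move=> a b ab; rewrite inordK; lia.
  by apply; exact: ik.
apply: le_trans (hC f s w i s0 wP) _; rewrite ler_wpM2r//.
  rewrite addr_ge0//; first by apply: Rintegral_ge0 => x _; exact: sqr_ge0.
  rewrite mulr_ge0//; first by rewrite exprn_ge0// ltW.
  by apply: sumr_ge0 => a _; apply: Rintegral_ge0 => x _; exact: sqr_ge0.
by rewrite (bigD1 f)//= lerDl sumr_ge0.
Qed.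

End local_bound.

(** * Grid geometry *)

Section grid_geometry.
Context {R : realType} {d : nat}.
Local Notation mu := (lebesgue_rV d).
Implicit Types (s : R) (i j k : 'rV[int]_d) (x : 'rV[R]_d) (I : set 'rV[int]_d).

Lemma element_closure_eq s i j x : 0 < s ->
  element s i x -> closure (element s j) x -> i = j.
Proof.
move=> s0 xi /(closure_elementP _ _ s0) xj; apply/rowP => l.
have /andP[i1 i2] := xi l; have /andP[j1 j2] := xj l.
have := lt_le_trans i1 j2; have := le_lt_trans j1 i2.
have e (a : int) : a%:~R + 1 = (a + 1)%:~R :> R by rewrite intrD.
by rewrite !ltr_pM2r// !e !ltr_int; move: (i _ _) (j _ _) => a b; lia.
Qed.

Lemma element_nonempty s i : 0 < s -> exists x, element s i x.
Proof.
move=> s0; exists (\row_l (((i ord0 l)%:~R + 2^-1) * s)) => l.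
by rewrite mxE !ltr_pM2r//; apply/andP; split; lra.
Qed.

(** An open element meets no closure of another one. Inclusions in a union of elements thus become
    membership of indices. *)
Lemma element_sub_union s I i : 0 < s ->
  element s i `<=` union_elements s I <-> I i.
Proof.
move=> s0; split=> [iI|Ii].
  have [x xi] := element_nonempty i s0.
  have [j Ij xj] := interior_subset (iI _ xi).
  by rewrite (element_closure_eq s0 xi xj).
rewrite /union_elements -open_subsetE; last exact: open_element.
by move=> x xi; exists i => //; exact: subset_closure.
Qed.

Lemma open_union_elements s I : open (union_elements s I).
Proof. exact: open_interior. Qed.

Lemma neighbors_le1 s i j l : 0 < s -> neighbors s i j ->
  -1 <= j ord0 l - i ord0 l <= 1.
Proof.
move=> s0 [k [/(closure_elementP _ _ s0)/(_ l) + /(closure_elementP _ _ s0)/(_ l)]].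
have e (a : int) : a%:~R + 1 = (a + 1)%:~R :> R by rewrite intrD.
by rewrite mxE !ler_pM2r// !e !ler_int; move: (i _ _) (j _ _) (k _ _) => a b c; lia.
Qed.

(** A point of the domain may lie on a face, but it always belongs to the closure of an element
    meeting the domain in positive measure. *)
Lemma sub_fictitious s (Om : set 'rV[R]_d) : 0 < s -> open Om ->
  Om `<=` fictitious s Om.
Proof.
move=> s0 oOm; rewrite /fictitious /union_elements -open_subsetE// => x Omx.
pose i : 'rV[int]_d := \row_l Num.floor (x ord0 l / s).
have xi := in_cell_floor x s0; rewrite -/i in xi.
have xci : closure (element s i) x.
  by apply/closure_elementP => // l; have /andP[-> /ltW] := xi l.
exists i => //=; have [e e0 xe] := nbhs_rVP (open_nbhs_nbhs (conj oOm Omx)).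
(* The half-open cell of x leaves room above x in every coordinate; the box from x to [b] lies in
   the element and within e of x. *)
pose b l := Num.min (((i ord0 l)%:~R + 1) * s) (x ord0 l + e).
have xb l : x ord0 l < b l.
  by rewrite lt_min ltrDl e0 andbT; have /andP[] := xi l.
pose B := open_box (x ord0) b.
have muB : mu B = _ := lebesgue_rV_open_boxE (fun l => ltW (xb l)).
apply: (@lt_le_trans _ _ (mu B)).
  by rewrite muB lte_fin; apply: prodr_gt0 => l _; rewrite subr_gt0.
apply: le_measure; rewrite ?inE; first exact: measurable_open_box.
  by apply: measurableI; [exact: measurable_element|exact: open_measurable_rV].
move=> y yB; split.
  move=> l; have := yB l; rewrite /= in_itv/= lt_min => /and3P[y1 y2 _].
  by rewrite y2 andbT; have /andP[h _] := xi l; exact: le_lt_trans h y1.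
apply: xe => l; have := yB l; rewrite /= in_itv/= lt_min => /and3P[y1 _ y2].
by rewrite ltr_norml; apply/andP; split; lra.
Qed.

Lemma measurable_closure_element s i : measurable (closure (element s i)).
Proof.
rewrite -[closure _]setCK; apply: measurableC; apply: open_measurable_rV.
exact/closed_openC/closed_closure.
Qed.

(** The faces are negligible: the open and the closed box have the same finite measure. *)
Lemma integral_closure_element s i (f : 'rV[R]_d -> \bar R) : 0 < s ->
  measurable_fun [set: 'rV[R]_d] f -> (forall x, 0 <= f x)%E ->
  (\int[mu]_(x in closure (element s i)) f x = \int[mu]_(x in element s i) f x)%E.
Proof.
move=> s0 mf f0; have sub : element s i `<=` closure (element s i) :=
  @subset_closure _ _.
rewrite (@ge0_negligible_integral _ _ _ _ _ (closure (element s i) `\` element s i))//.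
- by congr (integral _ _ _); rewrite setDD; apply/setIidPr.
- by apply: measurableD; [exact: measurable_closure_element|exact: measurable_element].
- exact: measurable_closure_element.
- exact: measurable_funTS.
have muE : mu (closure (element s i)) = mu (element s i).
  pose a l := (i ord0 l)%:~R * s; pose b l := ((i ord0 l)%:~R + 1) * s.
  have -> : closure (element s i) = [set x : 'rV[R]_d | forall l, `[a l, b
    l]%classic (x ord0 l)].
    apply/seteqP; split=> x.
      by move=> /(closure_elementP _ _ s0) xl l; rewrite /= in_itv; exact: xl.
    by move=> xl; apply/closure_elementP => // l; have := xl l; rewrite /= in_itv.
  rewrite elementE lebesgue_rV_open_box (@lebesgue_rV_box R d (fun l => `[a l, b
    l]%classic)).
    by apply: eq_bigr => l _; rewrite !lebesgue_measure_itv.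
  by move=> l; exact: measurable_itv.
have foo := element_lty i s0.
transitivity (mu (closure (element s i)) - mu (closure (element s i) `&` element s
  i))%E.
  apply: measureD; [exact: measurable_closure_element|exact: measurable_element|].
  by rewrite [X in (X < _)%E]muE.
by rewrite muE ((setIidPr _ _).2 sub) subee// ge0_fin_numE.
Qed.

End grid_geometry.

(** * Sums over the grid and integrals over unions of elements *)

Section grid_sums.
Context {R : realType} {d : nat}.
Local Notation mu := (lebesgue_rV d).
Implicit Types (s : R) (i j k : 'rV[int]_d) (x : 'rV[R]_d) (I : set 'rV[int]_d).

(** [undup] yields uniqueness without an injectivity proof for the indexing map. *)
Definition int_box (L : nat) : seq 'rV[int]_d :=
  undup [seq \row_l ((f l)%:Z - L%:Z) | f : {ffun 'I_d -> 'I_(2 * L).+1}].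

Lemma mem_int_box L i : (forall l, - L%:Z <= i ord0 l <= L%:Z) -> i \in int_box L.
Proof.
move=> iL; rewrite mem_undup; apply/mapP.
exists [ffun l => inord (absz (i ord0 l + L%:Z)%R)]; first by rewrite mem_enum.
apply/rowP => l; rewrite mxE ffunE.
have : forall a : int, - L%:Z <= a <= L%:Z ->
    a = (inord (absz (a + L%:Z)%R) : 'I_(2 * L).+1)%:Z - L%:Z.
  by move=> a aL; rewrite inordK; lia.
by apply; exact: iL.
Qed.

(** Compares a sum over a shifted index list with the sum over the original list containing the
    support. *)
Lemma ler_sum_support (T : eqType) (r r' : seq T) (F : T -> R) : uniq r ->
  (forall t, 0 <= F t) -> (forall t, t \in r -> t \notin r' -> F t = 0) ->
  \sum_(t <- r) F t <= \sum_(t <- r') F t.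
Proof.
move=> + F0; elim: r r' => [|t r IH] r' /=.
  by move=> _ _; rewrite big_nil sumr_ge0.
move=> /andP[tr ur] Fr; rewrite big_cons.
have [tr'|tr'] := boolP (t \in r'); last first.
  rewrite Fr ?mem_head// add0r; apply: IH => // u ur1; apply: Fr.
  by rewrite inE ur1 orbT.
rewrite (big_rem t tr') lerD2l; apply: IH => // u ur1 ur'.
apply: Fr; first by rewrite inE ur1 orbT.
apply: contra ur' => ur'; have ut : u != t by apply: contraNneq tr => <-.
by move: ur'; rewrite (perm_mem (perm_to_rem tr')) inE (negbTE ut).
Qed.

(** The sum over A would be 0 by default for an infinite support; here the list r contains the
    support. *)
Lemma fsbig_seqE (T : choiceType) (A : set T) (r : seq T) (F : T -> R) : uniq r ->
  (forall t, A t -> t \notin r -> F t = 0) ->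
  \sum_(t \in A) F t = \sum_(t <- r | t \in A) F t.
Proof.
move=> ur Fr; rewrite fsbig_mkcond -(@fsbig_widen _ _ _ _ [set` r] setT)//.
  by rewrite -fsbig_seq// [RHS]big_mkcond.
move=> t [_ /= /negP tr]; rewrite /= patchE; case: ifPn => // /set_mem At.
exact: Fr.
Qed.

Lemma pum_fun_support s w : 0 < s -> exists2 B : seq 'rV[int]_d, uniq B &
  forall i x, closure (element s i) x -> i \notin B -> pum_fun s w x = 0.
Proof.
(* L dominates every center coordinate. The summand 1 makes up for the width of an element: if i_l <
   -L, even its upper end i_l + 1 is at distance at least 1 from the center. *)
move=> s0; pose L := (\sum_(t <- w) \sum_l absz (t.1.2 ord0 l)%R + 1)%N.
exists (int_box L); first exact: undup_uniq.
move=> i x /(closure_elementP _ _ s0) xi iL; rewrite /pum_fun big_seq big1// => t tw.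
have /existsNP[l il] : ~ forall l, - L%:Z <= i ord0 l <= L%:Z.
  by move=> h; move: iL; rewrite mem_int_box.
rewrite pouE// (bigD1 l)//= hat_eq0 ?mul0r ?mulr0//.
have tL : (absz (t.1.2 ord0 l)%R + 1 <= L)%N.
  rewrite leq_add2r (big_rem t tw)/= (bigD1 l)//= -!addnA; exact: leq_addr.
have /andP[x1 x2] := xi l.
have x3 : (i ord0 l)%:~R <= x ord0 l / s by rewrite ler_pdivlMr.
have x4 : x ord0 l / s <= (i ord0 l)%:~R + 1 by rewrite ler_pdivrMr.
have [h|h] : i ord0 l + 2 <= t.1.2 ord0 l \/ t.1.2 ord0 l + 1 <= i ord0 l.
- have aux (a b : int) (c : nat) : ~ (- c%:Z <= a <= c%:Z) -> (absz b + 1 <= c)%N ->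
    a + 2 <= b \/ b + 1 <= a by lia.
  exact: aux il tL.
- have : ((i ord0 l + 2)%:~R : R) <= (t.1.2 ord0 l)%:~R by rewrite ler_int.
  by rewrite intrD => ?; rewrite ler_normr; apply/orP; right; lra.
- have : ((t.1.2 ord0 l + 1)%:~R : R) <= (i ord0 l)%:~R by rewrite ler_int.
  by rewrite intrD => ?; rewrite ler_normr; apply/orP; left; lra.
Qed.

Section integrals.
Variables (s : R) (g : 'rV[R]_d -> R) (B : seq 'rV[int]_d).
Hypotheses (s0 : 0 < s) (cg : continuous g).
Let f x := (g x ^+ 2)%:E.

Let f0 x : (0 <= f x)%E. Proof. by rewrite lee_fin sqr_ge0. Qed.

Let mf : measurable_fun [set: 'rV[R]_d] f.
Proof.
apply/measurable_EFinP; apply: continuous_measurable_rV => x.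
by apply: (@continuousM _ _ g g x); exact: cg.
Qed.

(** Closed elements cover the union, and g vanishes on those outside B. Overlaps on faces are
    harmless for an upper bound. *)
Lemma integral_union_elements_le I :
  (forall i x, closure (element s i) x -> i \notin B -> g x = 0) ->
  (\int[mu]_(x in union_elements s I) f x <=
   \sum_(i <- B | i \in I) \int[mu]_(x in element s i) f x)%E.
Proof.
move=> gB; pose F i := f \_ (closure (element s i)).
have mF i : measurable_fun [set: 'rV[R]_d] (F i).
  apply: (measurable_restrictT _ (measurable_closure_element s i)).1.
  exact: measurable_funTS.
have F0 i x : (0 <= F i x)%E by rewrite /F patchE; case: ifP.
have mU : measurable (union_elements s I).
  by apply: open_measurable_rV; exact: open_union_elements.
rewrite -big_filter; set r := [seq i <- B | i \in I].
apply: (@le_trans _ _ (\int[mu]_(x in union_elements s I) (\sum_(i <- r) F i x))%E).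
  apply: ge0_le_integral => //.
  - exact: measurable_funTS.
  - by apply: measurable_funTS; apply: emeasurable_sum.
  move=> x /interior_subset[i Ii xi].
  have [iB|iB] := boolP (i \in B); last first.
    by rewrite /f (gB i x xi iB) expr0n/= sume_ge0.
  rewrite (big_rem i)/=; last by rewrite mem_filter mem_set.
  by rewrite {1}/F patchE mem_set// leeDl// sume_ge0.
rewrite ge0_integral_sum//; last by move=> i; exact: measurable_funTS.
apply: lee_sum => i _; rewrite -integral_closure_element// [leRHS]integral_mkcond.
exact: ge0_subset_integral.
Qed.

(** The lower bound uses the open elements, which are pairwise disjoint. *)
Lemma sum_elements_le_integral I (V : set 'rV[R]_d) : uniq B -> measurable V ->
  (forall i, I i -> element s i `<=` V) ->
  (\sum_(i <- B | i \in I) \int[mu]_(x in element s i) f x <=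
   \int[mu]_(x in V) f x)%E.
Proof.
move=> uB mV IV; rewrite -big_filter -ge0_integral_bigsetU//.
- have sV : \big[setU/set0]_(i <- [seq i <- B | i \in I]) element s i `<=` V.
    rewrite -bigcup_seq => x [i /=]; rewrite mem_filter => /andP[/set_mem Ii _].
    exact: IV.
  apply: ge0_subset_integral => //; last exact: measurable_funTS.
  by apply: bigsetU_measurable => i _; exact: measurable_element.
- by move=> i; exact: measurable_element.
- exact: filter_uniq.
- move=> i j _ _ [x [xi xj]].
  exact: (element_closure_eq s0 xi (subset_closure xj)).
- exact: measurable_funTS.
Qed.

End integrals.

End grid_sums.

(** * Chains of cut elements *)

Section chains.
Context {R : realType} {d : nat}.
Local Notation mu := (lebesgue_rV d).
Implicit Types (s : R) (i j k : 'rV[int]_d) (x : 'rV[R]_d).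

(** One link turns a bound a S into C (a S + S). Writing C + 1 for C keeps the constants at least 1
    and increasing. *)
Definition chain_constant (C : R) (n : nat) : R := iter n (fun a => (C + 1) * (a +
  1)) 1.

Lemma chain_constantS C n : chain_constant C n.+1 = (C + 1) * (chain_constant C n + 1).
Proof. by []. Qed.

Lemma chain_constant_ge1 C n : 0 <= C -> 1 <= chain_constant C n.
Proof. by move=> C0; elim: n => // n; rewrite chain_constantS; nra. Qed.

Lemma chain_constant_le C m n : 0 <= C -> (m <= n)%N ->
  chain_constant C m <= chain_constant C n.
Proof.
move=> C0 /subnK <-; elim: (n - m)%N => [|p IH]; first by rewrite lexx.
rewrite addSn (le_trans IH)// chain_constantS.
have := chain_constant_ge1 (p + m) C0; nra.
Qed.

Lemma chain_le (T : Type) (N J : T -> R) (C S : R) (q : nat -> T) (n : nat) (t : T) :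
  0 <= C -> 0 <= S -> N t <= S -> (forall m, (m <= n)%N -> J (q m) <= S) ->
  (forall m, (m < n)%N -> N (q m) <= C * (N (q m.+1) + J (q m))) ->
  N (q n) <= C * (N t + J (q n)) -> N (q 0%N) <= chain_constant C n.+1 * S.
Proof.
move=> C0 S0 tS JS step last.
(* Induction from the end of the chain, [p] being the number of links from m to n. *)
suff H p m : (m + p = n)%N -> N (q m) <= chain_constant C p.+1 * S by exact: H.
elim: p m => [|p IH] m mpn.
  rewrite addn0 in mpn; rewrite mpn (le_trans last)//.
  have := JS n (leqnn n); rewrite /chain_constant/=; nra.
have mn : (m < n)%N by rewrite -mpn addnS ltnS leq_addr.
apply: (le_trans (step m mn)).
have := IH m.+1; rewrite addSnnS => /(_ mpn) Nm.
have Jm := JS m (ltnW mn); have a1 := chain_constant_ge1 p.+1 C0.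
rewrite chain_constantS -mulrA; apply: (@le_trans _ _ (C * ((chain_constant C p.+1
  + 1) * S))).
  by rewrite ler_wpM2l// mulrDl mul1r lerD.
by rewrite ler_wpM2r ?lerDl// mulr_ge0//; lra.
Qed.

Lemma partial_eq0 s i (f : 'rV[R]_d -> R) (a : 'I_d -> nat) :
  (forall x, element s i x -> f x = 0) ->
  forall x, element s i x -> partial a f x = 0.
Proof.
(* The zero function as an empty tensor sum, whose derivatives are known from
   [partial_tensor_sum]. *)
pose z : 'rV[R]_d -> R := tensor_sum ([::] : seq unit) (fun=> 0) (fun _ _ => cst 0).
move=> f0 x xi; rewrite (@partial_local _ _ a _ f z (@open_element _ _ s i) _ x xi).
  by rewrite partial_tensor_sum /tensor_sum ?big_nil// => _ l; exact: smooth_cst.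
by move=> y yi; rewrite f0// /z /tensor_sum big_nil.
Qed.

End chains.

(** * Summation of the local estimates *)

Section coercivity.
Context {R : realType} {d : nat}.
Local Notation mu := (lebesgue_rV d).
Implicit Types (s : R) (i j k : 'rV[int]_d) (x : 'rV[R]_d).

Definition kept s (Om : set 'rV[R]_d) : set 'rV[int]_d :=
  [set i | (0 < mu (element s i `&` Om))%E].

Lemma sub_cut_partP s Om M i : 0 < s -> element s i `<=` cut_part s Om M <->
  kept s Om i /\ (~ element s i `<=` Om \/ M i).
Proof.
move=> s0; split=> [/(element_sub_union _ _ s0)[/(element_sub_union _ _ s0)]//|[Di
  cut]].
by apply/(element_sub_union _ _ s0); split=> //; apply/(element_sub_union _ _ s0).
Qed.

Lemma sub_uncut_partP s Om M i : 0 < s -> element s i `<=` uncut_part s Om M <->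
  kept s Om i /\ element s i `<=` Om /\ ~ M i.
Proof.
move=> s0; split=> [/(element_sub_union _ _ s0)[/(element_sub_union _ _ s0)]//|[Di
  uncut]].
by apply/(element_sub_union _ _ s0); split=> //; apply/(element_sub_union _ _ s0).
Qed.

(** What one element adds to the form when eps = 1. An element moved to the cut part by M counts
    through its derivatives, not its mass. *)
Definition local_energy P s Om M (g : 'rV[R]_d -> R) i : R :=
  (if i \in [set i | element s i `<=` uncut_part s Om M]
   then \int[mu]_(x in element s i) (g x ^+ 2) else 0) +
  (if i \in [set i | element s i `<=` cut_part s Om M]
   then s ^+ (2 * P.+1) * seminorm_sqr P s i g else 0).

Lemma seminorm_sqr_ge0 P s i (g : 'rV[R]_d -> R) : 0 <= seminorm_sqr P s i g.
Proof. by apply: sumr_ge0 => a _; apply: Rintegral_ge0 => x _; exact: sqr_ge0. Qed.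

Lemma local_energy_ge0 P s Om M g i : 0 < s -> 0 <= local_energy P s Om M g i.
Proof.
move=> s0; apply: addr_ge0; case: ifP => // _.
  by apply: Rintegral_ge0 => x _; exact: sqr_ge0.
by rewrite mulr_ge0 ?seminorm_sqr_ge0// exprn_ge0// ltW.
Qed.

(** A link changes each coordinate by at most 1, so the whole chain lies in the box of radius K
    around i. Each energy along it is thus bounded by the sum over that box. *)
Lemma element_bound P K : exists2 A : R, 0 <= A & forall s (w : seq (R * 'rV[int]_d
  * {ffun 'I_d -> nat})) Om M i,
    0 < s ->
  (forall t, t \in w -> (\sum_l t.2 l <= P)%N) -> chain_condition K s Om M ->
  kept s Om i ->
  \int[mu]_(x in element s i) (pum_fun s w x ^+ 2) <=
  A * \sum_(r <- int_box K) local_energy P s Om M (pum_fun s w) (i + r).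
Proof.
have [C C0 hC] := @local_bound R d P.
exists (chain_constant C K); first by rewrite (le_trans _ (chain_constant_ge1 K C0)).
move=> s w Om M i s0 wP chain Di.
set g := pum_fun s w; set T := local_energy P s Om M g.
have T0 k : 0 <= T k by exact: local_energy_ge0.
set S := \sum_(r <- _) _; have S0 : 0 <= S by exact: sumr_ge0.
have TS k : (forall l, - K%:Z <= k ord0 l - i ord0 l <= K%:Z) -> T k <= S.
  move=> kK; have kb : k - i \in int_box K.
    by apply: mem_int_box => l; rewrite !mxE; exact: kK.
  by rewrite /S (big_rem _ kb)/= subrKC lerDl sumr_ge0.
have TU k : element s k `<=` uncut_part s Om M ->
    \int[mu]_(x in element s k) (g x ^+ 2) <= T k.
  move=> ku; rewrite /T /local_energy mem_set// lerDl; case: ifP => // _.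
  by rewrite mulr_ge0 ?seminorm_sqr_ge0// exprn_ge0// ltW.
have TC k : element s k `<=` cut_part s Om M ->
    s ^+ (2 * P.+1) * seminorm_sqr P s k g <= T k.
  move=> kc; have kC : k \in [set k | element s k `<=` cut_part s Om M] by exact:
    mem_set.
  rewrite /T /local_energy kC lerDr.
  by case: ifP => // _; apply: Rintegral_ge0 => x _; exact: sqr_ge0.
have cS : S <= chain_constant C K * S by rewrite ler_peMl// chain_constant_ge1.
(* A kept element that is not cut is uncut, and its mass is its own energy. *)
have [ic|inc] := pselect (element s i `<=` cut_part s Om M); last first.
  apply: (le_trans _ cS); have iu : element s i `<=` uncut_part s Om M.
    apply/sub_uncut_partP => //; split=> //; split.
      by apply: contrapT => h; apply: inc; apply/sub_cut_partP => //; split=> //; left.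
    by move=> h; apply: inc; apply/sub_cut_partP => //; split=> //; right.
  apply: (le_trans (TU _ iu)); apply: TS => l; lia.
have [n [q [nK q0 qc qn [j [ju nj]]]]] := chain i ic.
have qi m l : (m <= n)%N -> - m%:Z <= q m ord0 l - i ord0 l <= m%:Z.
  elim: m => [_|m IH mn]; first by rewrite q0; lia.
  have := neighbors_le1 l s0 (qn m mn); have := IH (ltnW mn).
  by move: (q m _ _) (q m.+1 _ _) (i _ _) => a b c; lia.
(* The uncut neighbor is one link beyond [q n]; n < K still places it in the box. *)
have ji l : - n.+1%:Z <= j ord0 l - i ord0 l <= n.+1%:Z.
  have := neighbors_le1 l s0 nj; have := qi n l (leqnn n).
  by move: (q n _ _) (j _ _) (i _ _) => a b c; lia.
rewrite -q0; apply: (@le_trans _ _ (chain_constant C n.+1 * S)); last first.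
  by rewrite ler_wpM2r// chain_constant_le.
apply: (@chain_le _ _ (fun k => \int[mu]_(x in element s k) (g x ^+ 2))
  (fun k => s ^+ (2 * P.+1) * seminorm_sqr P s k g) C S q n j C0 S0).
- apply: (le_trans (TU _ ju)); apply: TS => l; have := ji l.
  by move: (j _ _) (i _ _) => a b; lia.
- move=> m mn; apply: (le_trans (TC _ (qc m mn))); apply: TS => l.
  by have := qi m l mn; move: (q m _ _) (i _ _) => a b; lia.
- by move=> m mn; apply: hC => // l; exact: neighbors_le1 (qn m mn).
- by apply: hC => // l; exact: neighbors_le1 nj.
Qed.

End coercivity.

Theorem theorem3p2 (R : realType) (d P K : nat) (d_gt0 : (0 < d)%N)
    (eps : R) (eps_gt0 : 0 < eps) :
  exists C : R, 0 < C /\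
    forall (s : R) (Om : set 'rV[R]_d) (M : set 'rV[int]_d),
      0 < s -> stein_domain Om -> movable s Om M -> chain_condition K s Om M ->
      forall u : 'rV[R]_d -> R, pum_space P s (fictitious s Om) u ->
        C * L2norm (fictitious s Om) u ^+ 2 <= stab_bilinear P eps s Om M u u.
Proof.
have [A A0 hA] := @element_bound R d P K.
pose b := int_box K : seq 'rV[int]_d; pose c1 := Num.min 1 eps.
have c10 : 0 < c1 by rewrite lt_min ltr01.
have An0 : 0 <= A * (size b)%:R by rewrite mulr_ge0.
(* [c1] bounds the weights 1 and eps from below, [size b] counts the uses of each element, and the
   added 1 keeps the denominator positive. *)
exists (c1 / (A * (size b)%:R + 1)); split; first by rewrite divr_gt0// ltr_wpDl.
move=> s Om M s0 [oOm _ _ _] _ chain u [w [wP uw]].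
set D := fictitious s Om in uw *.
pose g := pum_fun s w; have cg : continuous g := @continuous_pum_fun R d s w s0.
have OmD : Om `<=` D by exact: sub_fictitious.
pose U := [set i | element s i `<=` uncut_part s Om M].
pose Ct := [set i | element s i `<=` cut_part s Om M].
pose N i := \int[lebesgue_rV d]_(x in element s i) (g x ^+ 2).
pose J i := s ^+ (2 * P.+1) * seminorm_sqr P s i g.
pose T := local_energy P s Om M g.
have T0 i : 0 <= T i by exact: local_energy_ge0.
have [B uB gB] := pum_fun_support w s0.
have gB' i : i \notin B -> forall x, element s i x -> g x = 0.
  by move=> iB x xi; apply: (gB i) => //; exact: subset_closure.
have NE i : (\int[lebesgue_rV d]_(x in element s i) (g x ^+ 2)%:E)%E = (N i)%:E.
  rewrite /N /Rintegral fineK//; apply: integrable_fin_num; first exact: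
    measurable_element.
  apply: (@integrable_element _ _ s i (fun x => g x ^+ 2)) => // x.
  exact: (@continuousM _ _ g g x (cg x) (cg x)).
have N0 i : i \notin B -> N i = 0.
  move=> iB; rewrite /N /Rintegral integral0_eq// => x xi.
  by rewrite (gB' i iB x xi) expr0n.
have J0 i : i \notin B -> J i = 0.
  move=> iB; rewrite /J /seminorm_sqr big1 ?mulr0// => a _.
  rewrite /Rintegral integral0_eq// => x xi.
  by rewrite (partial_eq0 _ (gB' i iB) xi) expr0n.
have TB i : i \notin B -> T i = 0.
  by move=> iB; rewrite /T /local_energy -/(N i) -/(J i) N0// J0//; do 2 case: ifP;
    rewrite addr0.
have oD : open D by exact: open_union_elements.
have mg : measurable_fun [set: 'rV[R]_d] (fun x => (g x ^+ 2)%:E).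
  apply/measurable_EFinP; apply: continuous_measurable_rV => x.
  exact: (@continuousM _ _ g g x (cg x) (cg x)).
have Dle : (\int[lebesgue_rV d]_(x in D) (g x ^+ 2)%:E <= (\sum_(i <- B | i \in
  kept s Om) N i)%:E)%E.
  rewrite -sumEFin; under eq_bigr do rewrite -NE.
  exact: integral_union_elements_le.
(* Real integrals of infinite value default to 0, which would spoil the lower bound over Om. *)
have Doo : (\int[lebesgue_rV d]_(x in D) (g x ^+ 2)%:E < +oo)%E by rewrite
  (le_lt_trans Dle)// ltry.
have OmLe : (\int[lebesgue_rV d]_(x in Om) (g x ^+ 2)%:E <= \int[lebesgue_rV d]_(x
  in D) (g x ^+ 2)%:E)%E.
  apply: ge0_subset_integral => //; try exact: open_measurable_rV.
  - exact: measurable_funTS.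
  - by move=> x _; rewrite lee_fin sqr_ge0.
have Omge : \sum_(i <- B | i \in U) N i <= \int[lebesgue_rV d]_(x in Om) (u x * u x).
  rewrite (@eq_Rintegral _ _ _ (lebesgue_rV d) Om (fun x => g x ^+ 2)); last first.
    by move=> x /set_mem Omx; rewrite uw ?expr2//; exact: OmD.
  rewrite -lee_fin /Rintegral fineK; last first.
    by rewrite ge0_fin_numE ?(le_lt_trans OmLe)//; apply: integral_ge0 => x _;
      rewrite lee_fin sqr_ge0.
  rewrite -sumEFin; under eq_bigr do rewrite -NE.
  apply: sum_elements_le_integral => //; first exact: open_measurable_rV.
  by move=> i /(sub_uncut_partP _ _ _ s0)[_ []].
have Dnorm : L2norm D u ^+ 2 <= \sum_(i <- B | i \in kept s Om) N i.
  rewrite /L2norm sqr_sqrtr; last by apply: Rintegral_ge0 => x _; exact: sqr_ge0.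
  rewrite (@eq_Rintegral _ _ _ (lebesgue_rV d) D (fun x => g x ^+ 2)); last first.
    by move=> x /set_mem Dx; rewrite uw.
  rewrite -lee_fin /Rintegral fineK//.
  by rewrite ge0_fin_numE//; apply: integral_ge0 => x _; rewrite lee_fin sqr_ge0.
(* Cut elements lie in the open set D, where u and g agree, so their derivatives agree as well. *)
have stabE : stab_form P s Om M u u = \sum_(i <- B | i \in Ct) J i.
  rewrite /stab_form (@eq_fsbigr _ _ _ _ _ (fun i => seminorm_sqr P s i g)); last first.
    move=> i /set_mem /(sub_cut_partP _ _ _ s0)[Di _]; apply: eq_bigr => a _.
    have iD : element s i `<=` D by apply/element_sub_union.
    apply: eq_Rintegral => x /set_mem xi; rewrite -expr2; congr (_ ^+ 2).
    by apply: (@partial_local _ _ _ D _ g oD) => //; exact: iD.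
  rewrite (@fsbig_seqE _ _ _ B)//; last first.
    move=> i _ iB; have := J0 i iB; rewrite /J => /eqP.
    by rewrite mulf_eq0 expf_eq0 (gt_eqF s0) andbF => /eqP.
  by rewrite mulr_sumr.
have sumT : \sum_(i <- B) T i = \sum_(i <- B | i \in U) N i + \sum_(i <- B | i \in
  Ct) J i.
  by rewrite /T /local_energy big_split/= -!big_mkcond.
have main : \sum_(i <- B | i \in kept s Om) N i <= A * (size b)%:R * \sum_(i <- B) T i.
  apply: (@le_trans _ _ (\sum_(i <- B) A * \sum_(r <- b) T (i + r))).
    rewrite big_mkcond; apply: ler_sum => i _; case: ifPn => [/set_mem Di|_].
      exact: hA.
    by rewrite mulr_ge0// sumr_ge0.
  (* For a fixed offset r the indices i + r are distinct and T vanishes outside B, so each offset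
     costs at most the full sum of T. *)
  rewrite -mulr_sumr exchange_big -mulrA ler_wpM2l//.
  rewrite -sum1_size natr_sum mulr_suml; apply: ler_sum => r _; rewrite mul1r.
  rewrite -(big_map (fun i => i + r) xpredT T); apply: ler_sum_support => //.
    by rewrite map_inj_uniq//; exact: addIr.
  by move=> i _; exact: TB.
set Su := \sum_(i <- B | i \in U) N i in sumT Omge.
set Sc := \sum_(i <- B | i \in Ct) J i in sumT stabE.
have ST0 : 0 <= \sum_(i <- B) T i by exact: sumr_ge0.
have Su0 : 0 <= Su.
  by apply: sumr_ge0 => i _; apply: Rintegral_ge0 => x _; exact: sqr_ge0.
have Sc0 : 0 <= Sc.
  apply: sumr_ge0 => i _; by rewrite mulr_ge0 ?seminorm_sqr_ge0// exprn_ge0// ltW.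
rewrite /stab_bilinear stabE; apply: (@le_trans _ _ (c1 * (Su + Sc))); last first.
  rewrite mulrDr lerD//; last by rewrite ler_wpM2r// ge_min lexx orbT.
  by rewrite (le_trans _ Omge)// ler_piMl// ge_min lexx.
rewrite -sumT mulrAC -mulrA ler_wpM2l//; first exact: ltW.
have An1 : 0 < A * (size b)%:R + 1 by rewrite ltr_wpDl.
rewrite ler_pdivrMr// (le_trans Dnorm)// (le_trans main)//.
by rewrite mulrC ler_wpM2l// lerDl.
Qed.
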